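(* Let $\omega$ be a translation bounded measure on $\mathbb{R}^d$, and assume that its autocorrelation exists for a given van Hove sequence $\mathcal{A}=(A_n)_{n\in\mathbb{N}}$, so \[ \gamma_\omega=\omega\circledast\widetilde\omega=\lim_{n\to\infty}\frac{\omega_n*\widetilde{\omega_n}}{\operatorname{vol}(A_n)},\qquad \omega_n:=\omega|_{A_n}. \] Let $(\mu_n)_{n\in\mathbb{N}}$ be a sequence of finite measures with $\operatorname{supp}(\mu_n)\subseteq A_n$, and assume that the $\mu_n$ are equi-translation bounded and satisfy $(\mu_n-\omega_n)\rightsquigarrow0$ as $n\to\infty$. Then \[ \frac{1}{\operatorname{vol}(A_n)}\bigl(\mu_n*\widetilde{\mu_n}-\omega_n*\widetilde{\omega_n}\bigr)\xrightarrow{\ \pi\ }0\quad\text{as }n\to\infty . \] In particular, one has $\lim_{n\to\infty}\frac{\mu_n*\widetilde{\mu_n}}{\operatorname{vol}(A_n)}=\gamma_\omega$ in the vague topology.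
   Context: Measures are (complex) Radon measures on $\mathbb{R}^d$; limits of measures are vague limits unless stated otherwise. $C_{\mathsf c}(\mathbb{R}^d)$ is the space of continuous functions with compact support. For a measure $\nu$ and a compact $K$ that is the closure of its nonempty interior, $\|\nu\|_K=\sup_{t\in\mathbb{R}^d}|\nu|(t+K)$; $\nu$ is translation bounded if this is finite, and a family of measures is equi-translation bounded if $\|\cdot\|_K$ is uniformly bounded on it. For a function $g$, $\widetilde g(x)=\overline{g(-x)}$, and $\widetilde\nu(g)=\overline{\nu(\widetilde g)}$. $\omega|_A$ is the restriction of $\omega$ to $A$. Van Hove sequence: compact sets $A_m\subset A_{m+1}\subset\mathbb{R}^d$ with $\operatorname{vol}(\partial^KA_m)=o(\operatorname{vol}(A_m))$ as $m\to\infty$ for every compact $K\subset\mathbb{R}^d$, where $\partial^KA=(\overline{A+K}\setminus A^\circ)\cup((\overline{\mathbb{R}^d\setminus A}-K)\cap A)$. Mean convergence to $0$ for finite measures $\nu_n$ with $\operatorname{supp}(\nu_n)\subseteq A_n$: $\nu_n\rightsquigarrow0$ means that for every $g\in C_{\mathsf c}(\mathbb{R}^d)$, with $K=\operatorname{supp}(g)$, $\limsup_{n\to\infty}\frac{1}{\operatorname{vol}(A_n)}\int_{K+A_n}|\nu_n*g|(x)\,dx=0$. Product topology convergence $\nu_n\xrightarrow{\pi}0$ means $\|\nu_n*g\|_\infty\to0$ for every $g\in C_{\mathsf c}(\mathbb{R}^d)$. *)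

(* Defs.v *)
From HB Require Import structures.
From mathcomp Require Import all_boot all_order all_algebra.
From mathcomp Require Import all_classical all_reals all_analysis.
From mathcomp Require Import measurable_realfun complex.

Set Implicit Arguments.
Unset Strict Implicit.
Unset Printing Implicit Defensive.

Import Order.TTheory GRing.Theory Num.Theory.
Import numFieldNormedType.Exports.

Local Open Scope classical_set_scope.
Local Open Scope ring_scope.
Local Open Scope complex_scope.

Section borel_rV.
Context (R : realType) (d : nat).

Definition borel_rV : set (set 'rV[R]_d) := <<s @open 'rV[R]_d >>.

Let borel0 : borel_rV set0.
Proof. exact: sigma_algebra0. Qed.

Let borelC A : borel_rV A -> borel_rV (~` A).
Proof. exact: sigma_algebraC. Qed.

Let borel_bigcup (F : (set 'rV[R]_d)^nat) :
  (forall i, borel_rV (F i)) -> borel_rV (\bigcup_i F i).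
Proof. exact: sigma_algebra_bigcup. Qed.

HB.instance Definition _ := @isMeasurable.Build default_measure_display
  'rV[R]_d borel_rV borel0 borelC borel_bigcup.

End borel_rV.

Section measurable_rV.
Context (R : realType) (n : nat).

Lemma open_rV_bigcup (U : set 'rV[R]_n) : open U ->
  U = \bigcup_(p in [set p : 'rV[rat]_n * nat |
        ball (map_mx (@ratr R) p.1) (p.2.+1%:R^-1 : R) `<=` U])
        ball (map_mx (@ratr R) p.1) (p.2.+1%:R^-1 : R).
Proof.
move=> oU; apply/seteqP; split=> [x Ux|x [p pU /pU]//].
have /nbhs_ballP[e /= e0 eU] := open_nbhs_nbhs (conj oU Ux).
have [k ke] : exists k : nat, k.+1%:R^-1 + k.+1%:R^-1 <= e.
  have [k _ /(_ k (leqnn k))] := near_infty_natSinv_lt (PosNum (divr_gt0 e0 (ltr0n R 2))).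
  move=> /= ke; exists k; rewrite [leRHS](splitr e); exact: lerD (ltW ke) (ltW ke).
have k0 : 0 < k.+1%:R^-1 :> R by rewrite invr_gt0.
have q_ (i : 'I_n) : {q : rat | ball (x ord0 i) (k.+1%:R^-1 : R) (ratr q)}.
  apply: cid.
  have /rat_in_itvoo[q] : x ord0 i - k.+1%:R^-1 < x ord0 i + k.+1%:R^-1.
    by rewrite ltrD2l (lt_trans _ k0)// oppr_lt0.
  rewrite in_itv/= => /andP[a b]; exists q.
  by rewrite -ball_normE/= distrC ltr_distl a b.
pose q := (\row_i sval (q_ i)) : 'rV[rat]_n.
have xq : ball x (k.+1%:R^-1 : R) (map_mx (@ratr R) q).
  split=> // i j; rewrite !mxE (ord1 i); exact: (svalP (q_ j)).
exists (q, k) => /=; last exact: ball_sym.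
move=> y qy; apply: eU; apply: le_ball ke _ _; exact: ball_triangle xq qy.
Qed.

Lemma measurable_fun_rV d (T : measurableType d) (f : T -> 'rV[R]_n) :
  (forall i, measurable_fun setT (fun x => f x ord0 i)) ->
  measurable_fun setT f.
Proof.
move=> mf _ B; rewrite setTI.
have : <<s @open 'rV[R]_n >> `<=` [set B | measurable (f @^-1` B)].
  apply: smallest_sub.
    split=> [|A mA|F mF] /=.
    - by rewrite preimage_set0.
    - by rewrite setTD preimage_setC; exact: measurableC.
    - by rewrite preimage_bigcup; exact: bigcupT_measurable.
  move=> U oU /=; rewrite (open_rV_bigcup oU) preimage_bigcup.
  rewrite bigcup_mkcond; apply: countable_bigcupT_measurable => [|[q k]].
    exact: countableP.
  case: ifP => // _ /=.
  set r : R := k.+1%:R^-1.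
  rewrite [X in measurable X](_ : _ = \bigcap_(i in [set: 'I_n])
     (fun x => f x ord0 i) @^-1` ball (ratr (q ord0 i) : R) r); last first.
    apply/seteqP; split=> [x [_ xq] i _|x xq] /=.
      by have := xq ord0 i; rewrite mxE.
    split; first by rewrite /r.
    by move=> i j; rewrite (ord1 i) mxE; exact: (xq j I).
  apply: fin_bigcap_measurable => [|i _]; first exact: finite_finset.
  rewrite -[X in measurable X]setTI; apply: mf => //.
  exact: measurable_ball.
exact.
Qed.

End measurable_rV.

Section lebesgue_rV.
Context (R : realType).

Definition rV_cons d (p : R * 'rV[R]_d) : 'rV[R]_d.+1 :=
  row_mx (const_mx p.1 : 'rV[R]_1) p.2.

Lemma rV_cons0 d (p : R * 'rV[R]_d) : rV_cons p ord0 ord0 = p.1.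
Proof.
have <- : @lshift 1 d ord0 = ord0 :> 'I_d.+1 by exact/val_inj.
by rewrite [LHS](row_mxEl _ p.2) mxE.
Qed.

Lemma rV_consS d (p : R * 'rV[R]_d) i :
  rV_cons p ord0 (lift ord0 i) = p.2 ord0 i.
Proof.
have <- : @rshift 1 d i = lift ord0 i :> 'I_d.+1 by exact/val_inj.
exact: (row_mxEr (const_mx p.1 : 'rV[R]_1) p.2).
Qed.

Lemma measurable_coord d (i : 'I_d) :
  measurable_fun setT (fun v : 'rV[R]_d => v ord0 i).
Proof.
apply: (measurability _ (RGenOpens.measurableE R)) => _ [_ [a [b ->]] <-].
rewrite setTI; apply: sub_sigma_algebra => /=.
apply: open_comp; last exact: interval_open.
by move=> x _; exact: coord_continuous.
Qed.

Lemma measurable_rV_cons d : measurable_fun setT (@rV_cons d).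
Proof.
apply: measurable_fun_rV => i.
have [j ->|->] := unliftP ord0 i.
  rewrite (_ : (fun x => _) = (fun v : 'rV[R]_d => v ord0 j) \o snd); last first.
    by apply/funext => p /=; rewrite rV_consS.
  by apply: measurableT_comp => //; exact: measurable_coord.
rewrite (_ : (fun x => _) = fst) //.
by apply/funext => p /=; rewrite rV_cons0.
Qed.

(* Lebesgue measure on [R^(d+1)] is the image of the product of the Lebesgue
   measures on [R] and [R^d]; it is shown below to be a sigma-finite measure
   and to give each box the product of its side lengths. *)
Fixpoint lebesgue_rV d : set 'rV[R]_d -> \bar R :=
  match d with
  | 0 => \d_(0 : 'rV[R]_0)
  | d'.+1 => pushforward (@lebesgue_measure R \x @lebesgue_rV d')%E (@rV_cons d')
  end.

Definition box d (a b : 'rV[R]_d) : set 'rV[R]_d :=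
  [set v | forall i, v ord0 i \in `[a ord0 i, b ord0 i]].

Lemma measurable_box d (a b : 'rV[R]_d) : measurable (box a b).
Proof.
rewrite (_ : box a b = \bigcap_(i in [set: 'I_d])
  (fun v : 'rV[R]_d => v ord0 i) @^-1` `[a ord0 i, b ord0 i]%classic).
  apply: fin_bigcap_measurable => [|i _]; first exact: finite_finset.
  by rewrite -[X in measurable X]setTI; exact: measurable_coord.
by apply/seteqP; split=> [x xab i _|x xab i]; [exact: xab|exact: (xab i)].
Qed.

Let box_volume d := forall a b : 'rV[R]_d,
  (forall i, a ord0 i <= b ord0 i) ->
  @lebesgue_rV d (box a b) = (\prod_i (b ord0 i - a ord0 i))%:E.

Let sigma_finite_box d (m : {measure set 'rV[R]_d -> \bar R}) :
  m = @lebesgue_rV d :> (set _ -> _) -> box_volume d -> sigma_finite setT m.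
Proof.
move=> mE boxE; exists (fun n => box (const_mx (- n%:R)) (const_mx n%:R)).
  apply/esym; rewrite -subTset => v _.
  exists (Num.truncn `|v|).+1 => // i; rewrite !mxE in_itv/= -ler_norml.
  apply: le_trans (ltW (truncnS_gt _)).
  by rewrite [leRHS]/Num.norm/= mx_normrE; apply: (le_bigmax _ _ (ord0, i)).
move=> n; split; first exact: measurable_box.
rewrite mE boxE ?ltry// => i; rewrite !mxE.
by rewrite (@le_trans _ _ 0)// oppr_le0.
Qed.

Let lebesgue_rV_exists d :
  (exists m : {measure set 'rV[R]_d -> \bar R},
    m = @lebesgue_rV d :> (set _ -> _)) /\ box_volume d.
Proof.
elim: d => [|d [[m mE] IH]].
  split; first by exists \d_(0 : 'rV[R]_0).
  by move=> a b _; rewrite big_ord0 /= diracE mem_set// => -[].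
have sf := sigma_finite_box mE IH; case: m mE sf => m [c0 c1] /= mE sf.
pose iS := Measure_isSigmaFinite.Axioms_ m c0 c1 sf.
pose M : {sigma_finite_measure set 'rV[R]_d -> \bar R} := HB.pack m c0 c1 iS.
have ME : M = @lebesgue_rV d :> (set _ -> _) by exact: mE.
split.
  pose P : {measure set _ -> \bar R} := (@lebesgue_measure R \x M)%E.
  pose Q := measure_function_pushforward__canonical__measure_function_Measure
    P (@measurable_rV_cons d).
  by exists Q; rewrite [RHS]/= -ME.
move=> a b ab; rewrite /= /pushforward -ME.
pose a' := \row_i a ord0 (lift ord0 i); pose b' := \row_i b ord0 (lift ord0 i).
rewrite (_ : _ @^-1` _ = `[a ord0 ord0, b ord0 ord0]%classic `*` box a' b').
  rewrite product_measure1E//; last exact: measurable_box.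
  rewrite ME IH => [|i]; last by rewrite !mxE.
  rewrite big_ord_recl EFinM; congr (_ * _)%E.
    rewrite [LHS](lebesgue_measure_itv `[a ord0 ord0, b ord0 ord0])/= lte_fin.
    have := ab ord0; rewrite le_eqVlt => /predU1P[->|->//].
    by rewrite ltxx subrr.
  by congr _%:E; apply: eq_bigr => i _; rewrite !mxE.
apply/seteqP; split=> [p pab|p [/= p1 p2] i].
  split; first by have := pab ord0; rewrite rV_cons0.
  by move=> i; have := pab (lift ord0 i); rewrite rV_consS !mxE.
have [j ->|->] := unliftP ord0 i; last by rewrite rV_cons0.
by rewrite rV_consS; have := p2 j; rewrite !mxE.
Qed.

Lemma lebesgue_rV_box d (a b : 'rV[R]_d) :
  (forall i, a ord0 i <= b ord0 i) ->
  @lebesgue_rV d (box a b) = (\prod_i (b ord0 i - a ord0 i))%:E.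
Proof. exact: (lebesgue_rV_exists d).2. Qed.

Section instances.
Variable d : nat.

Let m := sval (cid (lebesgue_rV_exists d).1).
Let mE : m = @lebesgue_rV d :> (set _ -> _).
Proof. exact: (svalP (cid (lebesgue_rV_exists d).1)). Qed.

Let lebesgue_rV0 : @lebesgue_rV d set0 = 0%E.
Proof. by rewrite -mE. Qed.

Let lebesgue_rV_ge0 A : (0 <= @lebesgue_rV d A)%E.
Proof. by rewrite -mE. Qed.

Let lebesgue_rV_sigma_additive : semi_sigma_additive (@lebesgue_rV d).
Proof. by rewrite -mE; exact: measure_semi_sigma_additive. Qed.

HB.instance Definition _ := isMeasure.Build _ _ _ (@lebesgue_rV d)
  lebesgue_rV0 lebesgue_rV_ge0 lebesgue_rV_sigma_additive.

Let lebesgue_rV_sigma_finite : sigma_finite setT (@lebesgue_rV d).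
Proof. by rewrite -mE; exact: sigma_finite_box mE (lebesgue_rV_exists d).2. Qed.

HB.instance Definition _ := Measure_isSigmaFinite.Build _ _ _ (@lebesgue_rV d)
  lebesgue_rV_sigma_finite.

End instances.

End lebesgue_rV.

Section complex_measures.
Context (R : realType) (d : nat).
Local Notation E := 'rV[R]_d.
Local Notation C := R[i].

Definition vol (A : set E) : R := fine (lebesgue_rV A).

Definition fsupp (g : E -> C) : set E := closure [set x | g x != 0].

Definition Cc (g : E -> C) : Prop :=
  continuous (g : E -> C^o) /\ compact (fsupp g).

(* [nu = nu_0 + i nu_1 - nu_2 - i nu_3] for positive locally finite Borel
   measures [nu_k] (automatically regular on [R^d]). The [nu_k] are not
   determined by [nu]; every notion below depends only on [nu]. *)
Record cmeasure := CMeasure {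
  cpart : 'I_4 -> {measure set E -> \bar R};
  cpart_lfinite : forall k K, compact K -> (cpart k K < +oo)%E }.

(* A finite complex measure is one that can be written with finite parts. *)
Definition finite_cmeasure (nu : cmeasure) : Prop :=
  forall k, (cpart nu k setT < +oo)%E.

(* The value on a bounded Borel set; meaningless when some part is infinite. *)
Definition cmeasure_set (nu : cmeasure) (B : set E) : C :=
  \sum_(k < 4) 'i ^+ k * (fine (cpart nu k B))%:C.

(* [|nu|(B)], as a supremum over the countable Borel partitions of [B]; it is
   used only for bounded [B]. *)
Definition tvar (nu : cmeasure) (B : set E) : \bar R :=
  ereal_sup [set \sum_(i <oo) (Normc.normc (cmeasure_set nu (F i)))%:E | F in
    [set F : (set E)^nat | [/\ forall i, measurable (F i),
       trivIset setT F & \bigcup_i F i = B]]]%E.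

Definition csupp (nu : cmeasure) : set E :=
  [set x | forall r : R, 0 < r -> (0 < tvar nu (ball x r))%E].

Definition regular_compact (K : set E) : Prop :=
  [/\ compact K, interior K !=set0 & K = closure (interior K)].

Definition tnorm (K : set E) (nu : cmeasure) : \bar R :=
  ereal_sup [set tvar nu [set t + y | y in K] | t in [set: E]].

(* The norms for different [K] are equivalent, so one [K] is enough. *)
Definition translation_bounded (nu : cmeasure) : Prop :=
  exists2 K, regular_compact K & (tnorm K nu < +oo)%E.

Definition equi_translation_bounded (nu : nat -> cmeasure) : Prop :=
  exists2 K, regular_compact K &
    exists c : R, forall n, (tnorm K (nu n) <= c%:E)%E.

Definition integralC (m : {measure set E -> \bar R}) (A : set E) (g : E -> C)
    : C :=
  (\int[m]_(x in A) complex.Re (g x)) +i* (\int[m]_(x in A) complex.Im (g x)).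

(* Measures act on functions, so restrictions, convolutions and linear
   combinations of measures are given through their action. *)
Definition functional := (E -> C) -> C.

Definition mrestriction (nu : cmeasure) (A : set E) : functional :=
  fun g => \sum_(k < 4) 'i ^+ k * integralC (cpart nu k) A g.

Definition functional_of_cmeasure (nu : cmeasure) : functional :=
  mrestriction nu setT.

Definition ftilde (g : E -> C) : E -> C := fun x => (g (- x))^*.

Definition mtilde (nu : functional) : functional :=
  fun g => (nu (ftilde g))^*.

Definition mconv (nu rho : functional) : functional :=
  fun g => nu (fun x => rho (fun y => g (x + y))).

Definition mconvf (nu : functional) (g : E -> C) : E -> C :=
  fun x => nu (fun y => g (x - y)).

Definition mscalef (c : R) (nu : functional) : functional :=
  fun g => c%:C * nu g.

Definition msubf (nu rho : functional) : functional :=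
  fun g => nu g - rho g.

Definition supnorm (f : E -> C) : \bar R :=
  ereal_sup [set (Normc.normc (f x))%:E | x in [set: E]].

Definition minkowski_sum (A B : set E) : set E :=
  [set x + y | x in A & y in B].

Definition minkowski_diff (A B : set E) : set E :=
  [set x - y | x in A & y in B].

Definition van_hove_boundary (K A : set E) : set E :=
  (closure (minkowski_sum A K) `\` interior A) `|`
  (minkowski_diff (closure (~` A)) K `&` A).

Definition van_hove (A : nat -> set E) : Prop :=
  [/\ forall m, compact (A m),
      forall m, A m `<=` A m.+1 &
      forall K, compact K ->
        (fun m => vol (van_hove_boundary K (A m))) =o_\oo
        (fun m => vol (A m))].

Definition vague_limit (nu : nat -> functional) (l : functional) : Prop :=
  forall g, Cc g -> (nu n g : C^o) @[n --> \oo] --> (l g : C^o).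

Definition mean_null (A : nat -> set E) (nu : nat -> functional) : Prop :=
  forall g, Cc g ->
    limn_esup (fun n => ((vol (A n))^-1%:E *
      \int[@lebesgue_rV R d]_(x in minkowski_sum (fsupp g) (A n))
        (Normc.normc (mconvf (nu n) g x))%:E)%E) = 0%E.

Definition pi_null (nu : nat -> functional) : Prop :=
  forall g, Cc g -> supnorm (mconvf (nu n) g) @[n --> \oo] --> 0%E.

End complex_measures.

Coercion functional_of_cmeasure : cmeasure >-> functional.

(* Main.v *)
Require Import Defs.
From HB Require Import structures.
From mathcomp Require Import all_boot all_order all_algebra.
From mathcomp Require Import all_classical all_reals all_analysis.
From mathcomp Require Import measurable_realfun complex lra ring.

(** Write mu and om for the restrictions of [mu n] and [omega] to [A n]. The
    theorem rests on the identity
      mu * mu~ - om * om~ = (mu - om) * mu~ + om * (mu - om)~.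
    Evaluated at a translate of a test function [g], and after exchanging the
    integrations in the first term ([mrestriction_swap]), each term is, up to
    complex conjugation, the integral of a translate of h against nu. Here h is
    the convolution of mu - om with [g] or with its reflected conjugate, and nu
    is mu or om ([autocorrelation_sub]); the variation |nu| is bounded on all
    balls of a fixed radius, uniformly in n. Mean convergence says that the
    Lebesgue integral of |h| is o(vol (A n)), and the point is to replace
    Lebesgue measure by |nu|, which may be singular to it.

    This is possible because h is equicontinuous, uniformly in n, by the local
    bounds on mu and om ([mconvf_equicontinuous]). On a small cube, |h| is at
    most its mean over a smaller cube inside it plus a small constant eta, and
    |nu| of the cube is at most a constant c. Summing the means over a grid of
    small cubes gives a fixed multiple of the integral of |h|, hence
    o(vol (A n)). The constant eta contributes eta times |nu|(A n), and this
    total variation is bounded by counting cubes of a fixed size: the sets of a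
    van Hove sequence meet O(vol (A n)) of them ([card_cells_meeting],
    [van_hove_neighborhood]). The two sizes of cubes are handled together in
    [mrestriction_two_partitions], and the resulting estimate is
    [mrestriction_le_integral]. All bounds are uniform in the translation, which
    gives the convergence in the product topology; vague convergence follows,
    since the value at [g] is a convolution at 0.

    The variation measure itself is never formed: a local bound on |nu| is used
    in the form [locally_bounded_by], and integrals are compared with it through
    Riemann sums over cells. Volumes are computed for closed boxes only. *)

Import Order.TTheory GRing.Theory Num.Theory.
Import numFieldNormedType.Exports.

Local Open Scope classical_set_scope.
Local Open Scope ring_scope.

Set Implicit Arguments.
Unset Strict Implicit.
Unset Printing Implicit Defensive.

Local Notation normc := Normc.normc.

(** * Bounded Borel functions and complex measures *)

Section modulus.
Context {R : realType}.
Local Notation C := R[i].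
Local Open Scope complex_scope.
Implicit Types (z w : C) (x : R).

Lemma normc_ge0 z : 0 <= normc z.
Proof. by case: z => a b /=; exact: sqrtr_ge0. Qed.

Lemma normc_conj z : normc z^* = normc z.
Proof. by case: z => a b /=; rewrite sqrrN. Qed.

Lemma ler_normcD z w : normc (z + w) <= normc z + normc w.
Proof. exact: le_normcD. Qed.

Lemma normc_opp z : normc (- z) = normc z.
Proof. by case: z => a b /=; rewrite !sqrrN. Qed.

Lemma ler_normcB z w : normc (z - w) <= normc z + normc w.
Proof. by rewrite -[normc w]normc_opp ler_normcD. Qed.

Lemma ler_normc_sum (I : Type) (r : seq I) (P : pred I) (F : I -> C) :
  normc (\sum_(i <- r | P i) F i) <= \sum_(i <- r | P i) normc (F i).
Proof.
elim/big_ind2 : _ => [|z x w y zx wy|//]; first by rewrite Normc.normc0.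
by rewrite (le_trans (ler_normcD _ _))// lerD.
Qed.

Lemma normc_real x : normc x%:C = `|x|.
Proof. by rewrite /= expr0n/= addr0 sqrtr_sqr. Qed.

Lemma Re_le_normc z : `|complex.Re z| <= normc z.
Proof. by rewrite -lecR; exact: normc_ge_Re. Qed.

Lemma Im_le_normc z : `|complex.Im z| <= normc z.
Proof. by case: z => a b /=; rewrite -sqrtr_sqr ler_wsqrtr// lerDr sqr_ge0. Qed.

Lemma normc_le_ReIm z : normc z <= `|complex.Re z| + `|complex.Im z|.
Proof.
rewrite [X in normc X]complexE (le_trans (ler_normcD _ _))//.
by rewrite Normc.normcM !normc_real /= expr0n/= add0r expr1n sqrtr1 mul1r.
Qed.

Lemma normc_expi (k : nat) : normc ('i ^+ k : C) = 1.
Proof.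
elim: k => [|k IH]; first by rewrite expr0 Normc.normc1.
by rewrite exprS Normc.normcM IH mulr1 /= expr0n/= add0r expr1n sqrtr1.
Qed.

End modulus.

Section bounded_borel.
Context {R : realType} {d : nat}.
Local Notation E := 'rV[R]_d.
Local Notation C := R[i].
Local Open Scope complex_scope.

(** Against a measure that is finite on [A], every function of this class is
    integrable on [A], so that integrals can be added and scaled freely. *)
Definition bounded_borel (f : E -> C) :=
  [/\ measurable_fun setT (fun x => complex.Re (f x)),
      measurable_fun setT (fun x => complex.Im (f x)) &
      exists S, forall x, normc (f x) <= S].

Lemma bounded_borelD (f g : E -> C) : bounded_borel f -> bounded_borel g ->
  bounded_borel (fun x => f x + g x).
Proof.
move=> [fR fI [S fS]] [gR gI [S' gS]]; split.
- rewrite (_ : (fun _ => _) = (fun x => complex.Re (f x) + complex.Re (g x))).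
    exact: measurable_funD.
  by apply/funext => x; case: (f x) (g x) => ? ? [].
- rewrite (_ : (fun _ => _) = (fun x => complex.Im (f x) + complex.Im (g x))).
    exact: measurable_funD.
  by apply/funext => x; case: (f x) (g x) => ? ? [].
- by exists (S + S') => x; rewrite (le_trans (ler_normcD _ _))// lerD.
Qed.

Lemma bounded_borelZ (z : C) (f : E -> C) : bounded_borel f ->
  bounded_borel (fun x => z * f x).
Proof.
move=> [fR fI [S fS]]; split.
- rewrite (_ : (fun _ => _) = (fun x => complex.Re z * complex.Re (f x) -
      complex.Im z * complex.Im (f x))); last first.
    by apply/funext => x; case: (f x) z => ? ? [].
  by apply: measurable_funB; apply: measurable_funM => //; exact: measurable_cst.
- rewrite (_ : (fun _ => _) = (fun x => complex.Re z * complex.Im (f x) +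
      complex.Im z * complex.Re (f x))); last first.
    by apply/funext => x; case: (f x) z => ? ? [].
  by apply: measurable_funD; apply: measurable_funM => //; exact: measurable_cst.
- exists (normc z * S) => x; rewrite Normc.normcM ler_wpM2l//.
  exact: normc_ge0.
Qed.

Lemma bounded_borelB (f g : E -> C) : bounded_borel f -> bounded_borel g ->
  bounded_borel (fun x => f x - g x).
Proof.
move=> bf bg; under eq_fun do rewrite -[_ (g _)]mulN1r.
exact/bounded_borelD/bounded_borelZ.
Qed.

Lemma bounded_borel_cst (z : C) : bounded_borel (fun=> z).
Proof. by split; [exact: measurable_cst|exact: measurable_cst|exists (normc z)]. Qed.

Lemma bounded_borel_sum (I : Type) (r : seq I) (f : I -> E -> C) :
  (forall i, bounded_borel (f i)) ->
  bounded_borel (fun x => \sum_(i <- r) f i x).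
Proof.
move=> bf; elim: r => [|i r IH].
  by under eq_fun do rewrite big_nil; exact: bounded_borel_cst.
under eq_fun do rewrite big_cons.
exact: bounded_borelD.
Qed.

Lemma bounded_borel_indic (B : set E) : measurable B ->
  bounded_borel (fun x => (\1_B x)%:C).
Proof.
move=> mB; split.
- exact: measurable_indic.
- exact: measurable_cst.
- exists 1 => x; rewrite normc_real ger0_norm ?indicE ?ler0n//.
  by rewrite lern1 leq_b1.
Qed.

Section integralC.
Context (m : {measure set E -> \bar R}) (A : set E).
Hypotheses (mA : measurable A) (mAfin : (m A < +oo)%E).

Let integrable_bounded (f : E -> R) S : measurable_fun setT f ->
  (forall x, `|f x| <= S) -> m.-integrable A (EFin \o f).
Proof.
move=> mf fS; apply: measurable_bounded_integrable => //.
  exact: measurable_funS mf.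
exists S; split; first exact: num_real.
by move=> M SM x _ /=; rewrite (le_trans (fS x))// ltW.
Qed.

Lemma bounded_borel_integrable (f : E -> C) : bounded_borel f ->
  m.-integrable A (EFin \o (fun x => complex.Re (f x))) /\
  m.-integrable A (EFin \o (fun x => complex.Im (f x))).
Proof.
move=> [fR fI [S fS]]; split; apply: (@integrable_bounded _ S) => // x.
- exact: le_trans (Re_le_normc _) (fS x).
- exact: le_trans (Im_le_normc _) (fS x).
Qed.

Lemma integralCD (f g : E -> C) : bounded_borel f -> bounded_borel g ->
  integralC m A (fun x => f x + g x) = integralC m A f + integralC m A g.
Proof.
move=> /bounded_borel_integrable[fR fI] /bounded_borel_integrable[gR gI].
rewrite /integralC; apply/eqP; rewrite eq_complex /= -!RintegralD//.
by apply/andP; split; apply/eqP; apply: eq_Rintegral => x _;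
  case: (f x) (g x) => ? ? [].
Qed.

Lemma integralCZ (z : C) (f : E -> C) : bounded_borel f ->
  integralC m A (fun x => z * f x) = z * integralC m A f.
Proof.
move=> bf; have [fR fI] := bounded_borel_integrable bf.
have Z (r : R) (h : E -> R) : m.-integrable A (EFin \o h) ->
    m.-integrable A (EFin \o (fun x => r * h x)).
  move=> ih; rewrite (_ : _ \o _ = (fun x => r%:E * (EFin \o h) x)%E) //.
  exact: integrableZl.
case: z => a b; rewrite /integralC; apply/eqP; rewrite eq_complex /=.
rewrite -!RintegralZl// -RintegralB ?Z// -RintegralD ?Z//.
by apply/andP; split; apply/eqP; apply: eq_Rintegral => x _; case: (f x) => ? ?.
Qed.

Lemma integralC_indic (B : set E) : measurable B ->
  integralC m A (fun x => (\1_B x)%:C) = (fine (m (A `&` B)))%:C.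
Proof.
move=> mB; rewrite /integralC /=; apply/eqP; rewrite eq_complex /=.
by rewrite Rintegral_cst// mul0r eqxx andbT /Rintegral integral_indic// setIC.
Qed.

Lemma integralC_bound (f : E -> C) S : bounded_borel f -> 0 <= S ->
  (forall x, A x -> normc (f x) <= S) ->
  normc (integralC m A f) <= 2 * fine (m A) * S.
Proof.
move=> bf S0 fS; have [fR fI] := bounded_borel_integrable bf.
have bnd (h : E -> R) : m.-integrable A (EFin \o h) ->
    (forall x, A x -> `|h x| <= S) -> `|\int[m]_(x in A) h x| <= S * fine (m A).
  move=> ih hS; rewrite (le_trans (le_normr_Rintegral _ _))//.
  rewrite -Rintegral_cst//; apply: le_Rintegral => //.
  - exact: integrable_norm.
  - by apply: measurable_bounded_integrable => //; exact: bounded_cst.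
rewrite (le_trans (normc_le_ReIm _))// /integralC /=.
rewrite [leRHS](_ : _ = S * fine (m A) + S * fine (m A)); last by ring.
by apply: lerD; apply: bnd => // x Ax; rewrite (le_trans _ (fS x Ax))//
  ?Re_le_normc ?Im_le_normc.
Qed.

End integralC.

Section mrestriction.
Context (nu : cmeasure R d) (A : set E).

Definition finite_on := measurable A /\ forall k, (cpart nu k A < +oo)%E.

(** The factor 2 comes from bounding real and imaginary parts separately. *)
Definition mass : R := \sum_(k < 4) 2 * fine (cpart nu k A).

Lemma mass_ge0 : 0 <= mass.
Proof. by apply: sumr_ge0 => k _; rewrite mulr_ge0// fine_ge0. Qed.

Hypothesis finA : finite_on.

Lemma mrestrictionD (f g : E -> C) : bounded_borel f -> bounded_borel g ->
  mrestriction nu A (fun x => f x + g x) =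
  mrestriction nu A f + mrestriction nu A g.
Proof.
move=> bf bg; rewrite /mrestriction -big_split/=; apply: eq_bigr => k _.
by have [mA Afin] := finA; rewrite integralCD// mulrDr.
Qed.

Lemma mrestrictionZ (z : C) (f : E -> C) : bounded_borel f ->
  mrestriction nu A (fun x => z * f x) = z * mrestriction nu A f.
Proof.
move=> bf; rewrite /mrestriction mulr_sumr; apply: eq_bigr => k _.
by have [mA Afin] := finA; rewrite integralCZ// mulrCA.
Qed.

Lemma mrestrictionB (f g : E -> C) : bounded_borel f -> bounded_borel g ->
  mrestriction nu A (fun x => f x - g x) =
  mrestriction nu A f - mrestriction nu A g.
Proof.
move=> bf bg; rewrite -[in RHS]mulN1r -mrestrictionZ// -mrestrictionD//.
  by congr mrestriction; apply/funext => x; rewrite mulN1r.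
exact: bounded_borelZ.
Qed.

Lemma mrestriction0 : mrestriction nu A (fun=> 0) = 0.
Proof.
rewrite [X in mrestriction _ _ X](_ : _ = (fun=> 0 * 0)).
  by rewrite mrestrictionZ ?mul0r//; exact: bounded_borel_cst.
by apply/funext => x; rewrite mul0r.
Qed.

Lemma mrestriction_sum (I : Type) (r : seq I) (f : I -> E -> C) :
  (forall i, bounded_borel (f i)) ->
  mrestriction nu A (fun x => \sum_(i <- r) f i x) =
  \sum_(i <- r) mrestriction nu A (f i).
Proof.
move=> bf; elim: r => [|i r IH].
  rewrite big_nil -[RHS]mrestriction0.
  by congr mrestriction; apply/funext => x; rewrite big_nil.
rewrite big_cons -IH -mrestrictionD//; last exact: bounded_borel_sum.
by congr mrestriction; apply/funext => x; rewrite big_cons.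
Qed.

Lemma mrestriction_indic (B : set E) : measurable B ->
  mrestriction nu A (fun x => (\1_B x)%:C) = cmeasure_set nu (A `&` B).
Proof.
move=> mB; rewrite /mrestriction /cmeasure_set; apply: eq_bigr => k _.
by have [mA Afin] := finA; rewrite integralC_indic.
Qed.

Lemma mrestriction_mass (f : E -> C) S : bounded_borel f -> 0 <= S ->
  (forall x, A x -> normc (f x) <= S) ->
  normc (mrestriction nu A f) <= mass * S.
Proof.
move=> bf S0 fS; rewrite (le_trans (ler_normc_sum _ _ _))// mulr_suml.
apply: ler_sum => k _; rewrite Normc.normcM normc_expi mul1r.
by have [mA Afin] := finA; rewrite integralC_bound.
Qed.

Lemma eq_mrestriction (f g : E -> C) : (forall x, A x -> f x = g x) ->
  mrestriction nu A f = mrestriction nu A g.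
Proof.
move=> fg; rewrite /mrestriction; apply: eq_bigr => k _; congr (_ * _).
by rewrite /integralC; congr Complex; apply: eq_Rintegral => x /set_mem Ax;
  rewrite fg.
Qed.

End mrestriction.

End bounded_borel.

(** * Total variation and support *)

Section total_variation.
Context {R : realType} {d : nat}.
Local Notation E := 'rV[R]_d.
Local Notation C := R[i].
Local Open Scope complex_scope.

(** A finite disjoint family becomes a countable partition of [X] once the rest
    of [X] and empty sets are added. *)
Lemma sum_normc_le_tvar (nu : cmeasure R d) (X : set E) (I : finType)
    (B : I -> set E) : measurable X -> (forall i, measurable (B i)) ->
  trivIset setT B -> (forall i, B i `<=` X) ->
  ((\sum_i normc (cmeasure_set nu (B i)))%:E <= tvar nu X)%E.
Proof.
move=> mX mB tB BX.
pose F k := if k is k'.+1 then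
    if insub k' : option 'I_#|I| is Some i then B (enum_val i) else set0
  else X `\` \bigcup_i B i.
have mUB : measurable (\bigcup_i B i).
  by apply: fin_bigcup_measurable => //; exact: finite_finset.
apply: le_trans (ereal_sup_ubound _); last first.
  exists F => //; split.
  - move=> [|k] /=; first exact: measurableD.
    by case: insubP.
  - apply/trivIsetP => -[|k] [|l] //= _ _ kl.
    + case: insubP => [i _ _|_]; last by rewrite setI0.
      by rewrite setDE -setIA; apply/seteqP; split => // x [_ [+ Bx]]; apply; exists (enum_val i).
    + case: insubP => [i _ _|_]; last by rewrite set0I.
      by rewrite setDE; apply/seteqP; split => // x [Bx [_ +]]; apply; exists (enum_val i).
    + case: insubP => [i _ ik|_]; last by rewrite set0I.
      case: insubP => [j _ jl|_]; last by rewrite setI0.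
      move/trivIsetP : tB; apply => //.
      apply: contra_neq kl => /enum_val_inj ij.
      by rewrite -ik -jl ij.
  - apply/seteqP; split => [x [[|k] _] /=|x Xx]; first by case.
      by case: insubP => // i _ _; exact: BX.
    have [[i _ Bix]|nBx] := pselect ((\bigcup_i B i) x); last by exists 0%N.
    exists (enum_rank i).+1 => //=.
    by rewrite valK enum_rankK.
apply: le_trans (nneseries_lim_ge #|I|.+1 _); last first.
  by move=> k _ _; rewrite lee_fin normc_ge0.
rewrite big_nat_recl// big_mkord -sumEFin.
rewrite [leRHS](_ : _ = (normc (cmeasure_set nu (F 0%N)))%:E +
  \sum_i (normc (cmeasure_set nu (B i)))%:E)%E; last first.
  congr (_ + _)%E; rewrite [RHS](reindex_onto enum_val enum_rank)/=; last first.
    by move=> i _; rewrite enum_rankK.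
  apply: eq_big => [i|i _]; first by rewrite enum_valK eqxx.
  by rewrite valK.
by rewrite leeDr// lee_fin normc_ge0.
Qed.

(** Total variation at most [c] on every sup-norm ball of radius [r], stated
    with finite families so that no variation measure is needed. *)
Definition locally_bounded_by (nu : cmeasure R d) (r c : R) :=
  forall (q : E) (I : finType) (B : I -> set E),
    (forall i, measurable (B i)) -> trivIset setT B ->
    (forall i x, B i x -> `|x - q| <= r) ->
    \sum_i normc (cmeasure_set nu (B i)) <= c.

Lemma locally_bounded_byW (nu : cmeasure R d) r r' c c' : r' <= r -> c <= c' ->
  locally_bounded_by nu r c -> locally_bounded_by nu r' c'.
Proof.
move=> rr cc nurc q I B mB tB Bq; apply: le_trans cc.
by apply: (nurc q) => // i x Bx; rewrite (le_trans (Bq _ _ Bx)).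
Qed.

Lemma closed_measurable_rV (X : set E) : closed X -> measurable X.
Proof.
move=> cX; rewrite -[X]setCK; apply: measurableC.
by apply: sub_sigma_algebra; exact: closed_openC.
Qed.

Lemma open_measurable_rV (X : set E) : open X -> measurable X.
Proof. by move=> oX; apply: sub_sigma_algebra. Qed.

Lemma closed_translate (t : E) (K : set E) : closed K ->
  closed [set t + y | y in K].
Proof.
move=> cK; rewrite (_ : [set t + y | y in K] = (fun x => x - t) @^-1` K).
  apply: (@closed_comp _ _ (fun x : E => x - t)) => // x _.
  apply: (@cvgB _ _ _ (nbhs x) _ idfun (cst t) x t); first exact: cvg_id.
  exact: cvg_cst.
apply/seteqP; split => [_ [y Ky <-]|x /= Kx].
  by rewrite /= addrAC subrr add0r.
by exists (x - t) => //; rewrite addrC subrK.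
Qed.

(** The interior of [K] contains a ball, so every ball of half its radius lies
    in a translate of [K]. *)
Lemma tnorm_locally_bounded (K : set E) : regular_compact K ->
  exists2 r, 0 < r & forall (nu : cmeasure R d) (c : R),
    (tnorm K nu <= c%:E)%E -> locally_bounded_by nu r c.
Proof.
move=> [cK [x0 x0K] _].
have clK : closed K := compact_closed (@norm_hausdorff _ _) cK.
have /nbhs_ballP[e /= e0 eK] : nbhs x0 K by exact: x0K.
exists (e / 2); first by rewrite divr_gt0.
move=> nu c nuc q I B mB tB Bq; rewrite -lee_fin.
have Bt i : B i `<=` [set (q - x0) + y | y in K].
  move=> x Bx; exists (x - q + x0); last first.
    by rewrite addrC addrACA subrK subrr addr0.
  apply: eK; rewrite -ball_normE /= distrC addrK.
  by rewrite (le_lt_trans (Bq _ _ Bx))// ltr_pdivrMr// ltr_pMr// ltr1n.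
apply: le_trans (sum_normc_le_tvar _ _ mB tB Bt) _.
  by apply: closed_measurable_rV; exact: closed_translate.
by apply: le_trans nuc; apply: ereal_sup_ubound; exists (q - x0).
Qed.

Lemma translation_bounded_locally_bounded (nu : cmeasure R d) :
  translation_bounded nu ->
  exists r c, 0 < r /\ locally_bounded_by nu r c.
Proof.
move=> [K /tnorm_locally_bounded[r r0 Kr] nuK].
exists r, (fine (tnorm K nu)); split => //; apply: Kr.
by case: (tnorm K nu) nuK => // _; exact: leNye.
Qed.

End total_variation.

Section support.
Context {R : realType} {d : nat}.
Local Notation E := 'rV[R]_d.
Local Notation C := R[i].
Local Open Scope complex_scope.

(** The two differences of parts are the real and the imaginary part of the
    value on [B]. *)
Lemma cmeasure_set_eq0 (nu : cmeasure R d) (B : set E) : measurable B ->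
  finite_cmeasure nu -> cmeasure_set nu B = 0 ->
  cpart nu (inord 0) B = cpart nu (inord 2) B /\
  cpart nu (inord 1) B = cpart nu (inord 3) B.
Proof.
move=> mB finnu.
have fn k : cpart nu k B \is a fin_num.
  rewrite ge0_fin_numE// (le_lt_trans _ (finnu k))// le_measure ?inE//.
rewrite /cmeasure_set !big_ord_recl big_ord0 /= => /eqP.
rewrite eq_complex /= => /andP[/eqP + /eqP].
set a := fine _; set b := fine _; set c := fine _; set e := fine _.
move=> h1 h2.
have ac : a = c by lra.
have be : b = e by lra.
have inE0 : inord 0 = ord0 :> 'I_4 by apply/val_inj; rewrite /= inordK.
have inE1 : inord 1 = lift ord0 ord0 :> 'I_4 by apply/val_inj; rewrite /= inordK.
have inE2 : inord 2 = lift ord0 (lift ord0 ord0) :> 'I_4.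
  by apply/val_inj; rewrite /= inordK.
have inE3 : inord 3 = lift ord0 (lift ord0 (lift ord0 ord0)) :> 'I_4.
  by apply/val_inj; rewrite /= inordK.
rewrite inE0 inE1 inE2 inE3; split.
  by rewrite -[LHS]fineK// -[RHS]fineK// -/a -/c ac.
by rewrite -[LHS]fineK// -[RHS]fineK// -/b -/e be.
Qed.

(** The four parts need not vanish on [D]; they cancel in pairs there. *)
Lemma mrestriction_null (nu : cmeasure R d) (D : set E) (f : E -> C) :
  (forall B, measurable B -> B `<=` D ->
    cpart nu (inord 0) B = cpart nu (inord 2) B /\
    cpart nu (inord 1) B = cpart nu (inord 3) B) ->
  mrestriction nu D f = 0.
Proof.
move=> nuD.
have e02 : integralC (cpart nu (inord 0)) D f = integralC (cpart nu (inord 2)) D f.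
  by congr Complex; congr fine; apply: eq_measure_integral => B mB /(nuD _ mB)[].
have e13 : integralC (cpart nu (inord 1)) D f = integralC (cpart nu (inord 3)) D f.
  by congr Complex; congr fine; apply: eq_measure_integral => B mB /(nuD _ mB)[].
have kE (k : 'I_4) : 'i%C ^+ k * integralC (cpart nu k) D f =
    'i ^+ k * integralC (cpart nu (inord k)) D f by rewrite inord_val.
rewrite /mrestriction (eq_bigr _ (fun k _ => kE k)).
rewrite !big_ord_recl big_ord0 /bump /= /bump /= e02 e13.
by rewrite expr0 expr1 (exprS _ 2) sqr_i mulrN1 mul1r mulN1r; ring.
Qed.

Lemma cmeasure_set_outside_csupp (nu : cmeasure R d) (x : E) : ~ csupp nu x ->
  exists2 r : R, 0 < r & forall B, measurable B -> B `<=` ball x r ->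
    cmeasure_set nu B = 0.
Proof.
move=> /existsNP[r /not_implyP[r0 /negP]]; rewrite -leNgt => xr.
exists r => // B mB Bx.
apply: Normc.eq0_normc; apply/eqP; rewrite eq_le normc_ge0 andbT -lee_fin.
apply: le_trans xr.
have := @sum_normc_le_tvar _ _ nu (ball x r) unit (fun=> B).
rewrite big_const /= card_unit /= addr0; apply => //.
- by apply: open_measurable_rV; exact: ball_open.
- by apply/trivIsetP => -[] [].
Qed.

(** The complement of [A] is covered by countably many null balls with rational
    data, so null balls make the whole complement null. *)
Lemma cmeasure_set_outside (nu : cmeasure R d) (A : set E) :
  finite_cmeasure nu -> closed A -> csupp nu `<=` A ->
  forall B, measurable B -> B `<=` ~` A ->
    cpart nu (inord 0) B = cpart nu (inord 2) B /\
    cpart nu (inord 1) B = cpart nu (inord 3) B.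
Proof.
move=> finnu cA nuA B mB BA.
pose b (p : 'rV[rat]_d * nat) : set E :=
  ball (map_mx (@ratr R) p.1) (p.2.+1%:R^-1 : R).
pose null (X : set E) :=
  forall B, measurable B -> B `<=` X -> cmeasure_set nu B = 0.
pose F n : set E := if unpickle n is Some p then
  if `[< null (b p) >] then b p else set0 else set0.
have mF n : measurable (F n).
  rewrite /F; case: unpickle => // p; case: asboolP => // _.
  by apply: open_measurable_rV; exact: ball_open.
have nullF n : null (F n).
  have null0 : null set0.
    move=> Y _; rewrite subset0 => ->; rewrite /cmeasure_set big1// => k _.
    by rewrite measure0 mulr0.
  by rewrite /F; case: unpickle => // p; case: asboolP.
have BF : B = \bigcup_n (B `&` seqDU F n).
  rewrite -setI_bigcupr -seqDU_bigcup_eq; apply/esym/setIidPl => x /BA Ax.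
  have [r r0 xr] := cmeasure_set_outside_csupp (fun h => Ax (nuA _ h)).
  have : ball x r x by exact: ballxx.
  rewrite [X in X x](open_rV_bigcup (@ball_open _ _ x r)) => -[p /= pr xp].
  exists (pickle p) => //; rewrite /F pickleK.
  case: asboolP => // -[] Y mY Yp; apply: xr => //.
  exact: subset_trans pr.
have mD n : measurable (B `&` seqDU F n).
  by apply: measurableI => //; exact: seqDU_measurable.
have tD : trivIset setT (fun n => B `&` seqDU F n).
  by apply: trivIset_setIl; exact: trivIset_seqDU.
have D0 n : cmeasure_set nu (B `&` seqDU F n) = 0.
  by apply: (nullF n) => // x [_ Fx]; exact: subset_seqDU Fx.
rewrite BF !measure_bigcup//; split; apply: eq_eseriesr => n _.
- by have [] := cmeasure_set_eq0 (mD n) finnu (D0 n).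
- by have [] := cmeasure_set_eq0 (mD n) finnu (D0 n).
Qed.

(** This allows [nu] to be replaced by its restriction to a compact set, so that
    both measures of the theorem are treated as restrictions to [A n]. *)
Lemma cmeasure_supported (nu : cmeasure R d) (A : set E) (f : E -> C) :
  finite_cmeasure nu -> closed A -> csupp nu `<=` A -> bounded_borel f ->
  functional_of_cmeasure nu f = mrestriction nu A f.
Proof.
move=> finnu cA nuA bf.
have mA : measurable A := closed_measurable_rV cA.
rewrite -[RHS]addr0 -[X in _ + X](mrestriction_null f
  (cmeasure_set_outside finnu cA nuA)) -big_split; apply: eq_bigr => k _ /=.
rewrite -mulrDr; congr (_ * _).
have [iR iI] := bounded_borel_integrable measurableT (finnu k) bf.
have mCA : measurable (~` A) by exact: measurableC.
rewrite /integralC -(setUv A); apply/eqP; rewrite eq_complex /=.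
by rewrite !Rintegral_setU ?eqxx ?setUv//; exact/disj_setPCl.
Qed.

End support.

(** * Grids of cubes *)

Section grid.
Context {R : realType} {d : nat}.
Local Notation E := 'rV[R]_d.
Implicit Types (a s x y : E) (delta : R) (N : nat).

Lemma rV_normP (x : E) (r : R) : 0 <= r ->
  `|x| <= r <-> forall j, `|x ord0 j| <= r.
Proof.
move=> r0; split => [xr j|xr].
  apply: le_trans xr; rewrite [leRHS]/Num.norm/= mx_normrE.
  exact: (le_bigmax _ _ (ord0, j)).
rewrite [leLHS]/Num.norm/= mx_normrE; apply: bigmax_le => // -[i j] _ /=.
by rewrite (ord1 i).
Qed.

Definition grid_index N : finType := {ffun 'I_d -> 'I_N}.

(** Half-open cubes, so that they are disjoint and leave no gaps. *)
Definition cell a delta N (i : grid_index N) : set E :=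
  [set x | forall j, a ord0 j + (i j)%:R * delta <= x ord0 j <
                     a ord0 j + (i j).+1%:R * delta].

(** Volumes are computed for closed boxes; closed cubes of half the side, unlike
    those of the full side, are disjoint. *)
Definition half_cell a delta N (i : grid_index N) : set E :=
  box (\row_j (a ord0 j + (i j)%:R * delta))
      (\row_j (a ord0 j + (i j)%:R * delta + delta / 2)).

Lemma measurable_cell a delta N (i : grid_index N) :
  measurable (cell a delta i).
Proof.
rewrite (_ : cell a delta i = \bigcap_(j in [set: 'I_d])
  (fun v : 'rV[R]_d => v ord0 j) @^-1`
     `[a ord0 j + (i j)%:R * delta, a ord0 j + (i j).+1%:R * delta[%classic).
  apply: fin_bigcap_measurable => [|j _]; first exact: finite_finset.
  by rewrite -[X in measurable X]setTI; exact: measurable_coord.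
by apply/seteqP; split=> [x xi j _|x xi j]; have := xi j;
  rewrite /= in_itv/=; [|exact].
Qed.

Lemma cell_uniq a delta N (i i' : grid_index N) x : 0 < delta ->
  cell a delta i x -> cell a delta i' x -> i = i'.
Proof.
move=> d0 xi xi'; apply/ffunP => j; apply/val_inj => /=.
have aux (k l : nat) : a ord0 j + k%:R * delta <= x ord0 j ->
    x ord0 j < a ord0 j + l.+1%:R * delta -> (k <= l)%N.
  move=> h1 h2; have := le_lt_trans h1 h2.
  by rewrite ltrD2l ltr_pM2r// ltr_nat ltnS.
have /andP[h1 h2] := xi j; have /andP[h3 h4] := xi' j.
by apply/eqP; rewrite eqn_leq !aux.
Qed.

Lemma trivIset_cell a delta N : 0 < delta ->
  trivIset setT (@cell a delta N).
Proof.
move=> d0; apply/trivIsetP => i i' _ _ ii'; apply/seteqP; split => // x [xi xi'].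
by move/eqP : ii'; apply; exact: cell_uniq xi xi'.
Qed.

Lemma cell_diam a delta N (i : grid_index N) x y : 0 < delta ->
  cell a delta i x -> cell a delta i y -> `|x - y| <= delta.
Proof.
move=> d0 xi yi; apply/rV_normP => [|j]; first exact: ltW.
have /andP[h1 h2] := xi j; have /andP[h3 h4] := yi j.
move: h2 h4; rewrite -(natr1 (i j)) mulrDl mul1r !mxE => h2 h4.
by rewrite ler_norml; lra.
Qed.

Lemma half_cell_sub a delta N (i : grid_index N) : 0 < delta ->
  half_cell a delta i `<=` cell a delta i.
Proof.
move=> d0 x xi j; have := xi j; rewrite in_itv/= !mxE => /andP[-> /=].
move=> /le_lt_trans -> //; rewrite -(natr1 (i j)) mulrDl mul1r addrA ltrD2l.
by rewrite ltr_pdivrMr// ltr_pMr// ltr1n.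
Qed.

Lemma lebesgue_half_cell a delta N (i : grid_index N) : 0 < delta ->
  lebesgue_rV (half_cell a delta i) = ((delta / 2) ^+ d)%:E.
Proof.
move=> d0; rewrite lebesgue_rV_box => [|j]; last first.
  by rewrite !mxE lerDl divr_ge0// ltW.
congr _%:E; rewrite (eq_bigr (fun=> delta / 2)).
  by rewrite prodr_const card_ord.
by move=> j _; rewrite !mxE addrAC subrr add0r.
Qed.

(** A translate of a cell is a cell of the translated grid, so the volume of its
    half-size cube is again given by the formula for boxes. *)
Lemma cell_translate a s delta N (i : grid_index N) x :
  cell (a + s) delta i (x + s) <-> cell a delta i x.
Proof.
by split => xi j; have := xi j; rewrite !mxE; move=> /andP[h1 h2];
  apply/andP; split; lra.
Qed.

Lemma cell_cover a delta N x : 0 < delta ->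
  (forall j, a ord0 j <= x ord0 j < a ord0 j + N%:R * delta) ->
  exists i : grid_index N, cell a delta i x.
Proof.
move=> d0 xN.
pose k j := Num.truncn ((x ord0 j - a ord0 j) / delta).
have ax j : 0 <= (x ord0 j - a ord0 j) / delta.
  by rewrite divr_ge0 ?(ltW d0)// subr_ge0; have /andP[] := xN j.
have kN j : (k j < N)%N.
  have /andP[h1 h2] := xN j.
  by rewrite truncn_lt_nat// ltr_pdivrMr// ltrBlDl.
exists [ffun j => Ordinal (kN j)] => j; rewrite ffunE /=.
rewrite -lerBrDl -ltrBlDl -ler_pdivlMr// -ltr_pdivrMr//.
by rewrite truncn_le truncnS_gt andbT.
Qed.

Definition corner a delta N (i : grid_index N) : E :=
  \row_j (a ord0 j + (i j)%:R * delta).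

Lemma cell_corner a delta N (i : grid_index N) : 0 < delta ->
  cell a delta i (corner a delta i).
Proof. by move=> d0 j; rewrite !mxE lexx /= ltrD2l ltr_pM2r// ltr_nat. Qed.

Lemma cell_ball a delta N (i : grid_index N) r : 0 < delta -> delta <= r ->
  exists q : E, forall x, cell a delta i x -> `|x - q| <= r.
Proof.
move=> d0 dr; exists (corner a delta i) => x xi; apply: le_trans dr.
by apply: cell_diam (xi) _ => //; exact: cell_corner.
Qed.

Lemma grid_cover (q : E) (b delta : R) : 0 < delta -> 
  exists (a : E) , forall N x, 2 * b < N%:R * delta -> `|x - q| <= b ->
  exists i : grid_index N, cell a delta i x.
Proof.
move=> d0; exists (q - const_mx b) => N x Nb xq; apply: cell_cover => // j.
have b0 : 0 <= b := le_trans (normr_ge0 _) xq.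
have /(rV_normP _ b0)/(_ j) := xq.
by rewrite ler_norml !mxE => /andP[h1 h2]; apply/andP; split; lra.
Qed.

End grid.

(** * Riemann sums *)

Section riemann_sums.
Context {R : realType} {d : nat}.
Local Notation E := 'rV[R]_d.
Local Notation C := R[i].
Local Open Scope complex_scope.

Definition bounded_ucont (f : E -> C) :=
  (exists S : R, forall x, normc (f x) <= S) /\
  (forall e : R, 0 < e -> exists2 delta : R, 0 < delta &
     forall x y : E, `|x - y| <= delta -> normc (f x - f y) <= e).

Lemma continuous_measurable_rV (f : E -> R) : continuous f ->
  measurable_fun setT f.
Proof.
move=> cf; apply: (measurability _ (RGenOpens.measurableE R)) => _ [_ [a [b ->]] <-].
rewrite setTI; apply: open_measurable_rV.
by apply: open_comp; [move=> x _; exact: cf|exact: interval_open].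
Qed.

Lemma bounded_ucont_borel (f : E -> C) : bounded_ucont f -> bounded_borel f.
Proof.
move=> [fS fu].
have aux (p : C -> R) : (forall z w, `|p z - p w| <= normc (z - w)) ->
    measurable_fun setT (fun x => p (f x)).
  move=> pl; apply: continuous_measurable_rV => x.
  have FF : Filter (nbhs x) by exact: nbhs_filter.
  apply/(@cvgrPdist_le _ _ _ (nbhs x)) => e /fu[delta d0 fd].
  have := nbhsx_ballx x _ d0; apply: filterS => y; rewrite -ball_normE /= => xy.
  by rewrite (le_trans (pl _ _))// fd// ltW.
split => //; apply: aux => z w.
- by rewrite (le_trans _ (Re_le_normc _))//; case: z w => ? ? [].
- by rewrite (le_trans _ (Im_le_normc _))//; case: z w => ? ? [].
Qed.

Lemma bounded_ucont_shift (f : E -> C) s : bounded_ucont f ->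
  bounded_ucont (fun x => f (x + s)).
Proof.
move=> [[S fS] fu]; split; first by exists S.
move=> e /fu[delta d0 fd]; exists delta => // x y xy; apply: fd.
by rewrite opprD addrACA subrr addr0.
Qed.

Lemma bounded_ucont_reflect (f : E -> C) s : bounded_ucont f ->
  bounded_ucont (fun x => f (s - x)).
Proof.
move=> [[S fS] fu]; split; first by exists S.
move=> e /fu[delta d0 fd]; exists delta => // x y xy; apply: fd.
by rewrite opprD addrACA subrr add0r -opprD normrN.
Qed.

Lemma bounded_ucont_conj (f : E -> C) : bounded_ucont f ->
  bounded_ucont (fun x => (f x)^*).
Proof.
move=> [[S fS] fu]; split; first by exists S => x; rewrite normc_conj.
move=> e /fu[delta d0 fd]; exists delta => // x y /fd.
by rewrite -rmorphB normc_conj.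
Qed.

Lemma bounded_ucontB (f g : E -> C) : bounded_ucont f -> bounded_ucont g ->
  bounded_ucont (fun x => f x - g x).
Proof.
move=> [[S fS] fu] [[T gT] gu]; split.
  by exists (S + T) => x; rewrite (le_trans (ler_normcB _ _))// lerD.
move=> e e0; have e20 : 0 < e / 2 by rewrite divr_gt0.
have [r r0 fr] := fu _ e20; have [t t0 gt] := gu _ e20.
exists (Num.min r t); first by rewrite lt_min r0.
move=> x y; rewrite le_min => /andP[xyr xyt].
rewrite (_ : _ - _ = (f x - f y) - (g x - g y)); last by ring.
by rewrite (le_trans (ler_normcB _ _))// (splitr e) lerD ?fr ?gt.
Qed.

Lemma bounded_ucont_grid (f : E -> C) (A : set E) (b e : R) :
  bounded_ucont f -> (forall x, A x -> `|x| <= b) -> 0 < e ->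
  exists delta a N, [/\ 0 < delta,
    forall x, A x -> exists i : grid_index N, cell a delta i x &
    forall (i : grid_index N) x y, cell a delta i x -> cell a delta i y ->
      normc (f x - f y) <= e].
Proof.
move=> [_ fu] Ab e0; have [delta d0 fd] := fu _ e0.
have [a ha] := @grid_cover R d 0 b delta d0.
pose N := (Num.truncn (2 * b / delta)).+1.
have Nb : 2 * b < N%:R * delta by rewrite -ltr_pdivrMr// truncnS_gt.
exists delta, a, N; split => // [x Ax|i x y xi yi].
  by apply: ha => //; rewrite subr0; exact: Ab.
by apply: fd; exact: cell_diam xi yi.
Qed.

Section restricted.
Context (nu : cmeasure R d) (A : set E).
Hypothesis finA : finite_on nu A.

(** The crude error bound by the mass of [A] suffices, because [e] can be
    taken arbitrarily small while [A] is fixed. *)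
Lemma mrestriction_step (f : E -> C) (I : finType) (B : I -> set E) (v : I -> C)
    (e : R) : bounded_borel f -> 0 <= e ->
  (forall i, measurable (B i)) -> trivIset setT B ->
  (forall i x, A x -> B i x -> normc (f x - v i) <= e) ->
  (forall x, A x -> f x != 0 -> exists i, B i x) ->
  normc (mrestriction nu A f - \sum_i v i * cmeasure_set nu (A `&` B i))
    <= mass nu A * e.
Proof.
move=> bf e0 mB tB fv fB.
pose g x := \sum_i v i * (\1_(B i) x)%:C.
have bi i : bounded_borel (fun x : E => v i * (\1_(B i) x)%:C).
  exact/bounded_borelZ/bounded_borel_indic.
have -> : \sum_i v i * cmeasure_set nu (A `&` B i) = mrestriction nu A g.
  rewrite mrestriction_sum//; apply: eq_bigr => i _.
  by rewrite mrestrictionZ ?mrestriction_indic//; exact: bounded_borel_indic.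
have bg : bounded_borel g by apply: bounded_borel_sum.
rewrite -mrestrictionB//; apply: mrestriction_mass => //.
  exact: bounded_borelB.
move=> x Ax; have [[i Bix]|nB] := pselect (exists i, B i x).
  rewrite /g (bigD1 i)//= big1 => [|j ji].
    by rewrite addr0 indicE mem_set// mulr1; exact: fv Bix.
  rewrite indicE memNset ?mulr0// => Bjx; move/eqP : ji; apply.
  by apply: tB => //; exists x.
rewrite /g big1 => [|i _]; last first.
  by rewrite indicE memNset ?mulr0// => Bix; apply: nB; exists i.
rewrite subr0; have [->|/(fB _ Ax)/nB//] := eqVneq (f x) 0.
by rewrite Normc.normc0.
Qed.

End restricted.

Lemma ler_addgt0M (x y M : R) : 0 <= M ->
  (forall e, 0 < e -> x <= M * e + y) -> x <= y.
Proof.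
move=> M0 h; apply/ler_addgt0Pr => e e0.
have M1 : 0 < M + 1 by rewrite ltr_wpDl.
have := h (e / (M + 1)); rewrite divr_gt0// => /(_ isT)/le_trans; apply.
by rewrite addrC lerD2l mulrA ler_pdivrMr// mulrC ler_wpM2l ?ltW// ltrDl.
Qed.

Lemma locally_bounded_sum (nu : cmeasure R d) (r c : R) (q : E) (I : finType)
    (P : pred I) (B : I -> set E) : locally_bounded_by nu r c ->
  (forall i, measurable (B i)) -> trivIset setT B ->
  (forall i x, P i -> B i x -> `|x - q| <= r) ->
  \sum_(i | P i) normc (cmeasure_set nu (B i)) <= c.
Proof.
move=> nurc mB tB Bq.
rewrite big_mkcond/=.
rewrite (_ : \sum_i _ =
    \sum_i normc (cmeasure_set nu (if P i then B i else set0))); last first.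
  apply: eq_bigr => i _; case: ifP => // _.
  rewrite /cmeasure_set big1 ?Normc.normc0// => k _.
  by rewrite measure0 mulr0.
apply: (nurc q).
- by move=> i; case: ifP.
- move=> i j _ _ [x []]; case: ifP => // _ Bi; case: ifP => // _ Bj.
  by apply: tB => //; exists x.
- by move=> i x; case: ifP => // Pi; exact: Bq.
Qed.

(** Two partitions are used at once because the functions to be bounded are
    controlled by averages over small cells plus a constant error: charging
    the error to small cells would cost a factor depending on their size. *)
Lemma mrestriction_two_partitions (nu : cmeasure R d) (A : set E) (b r c : R)
    (f : E -> C) (I J : finType) (Q : I -> set E) (P : J -> set E)
    (S : I -> R) (T : J -> R) :
  finite_on nu A -> (forall x, A x -> `|x| <= b) ->
  locally_bounded_by nu r c -> bounded_ucont f ->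
  (forall i, measurable (Q i)) -> trivIset setT Q ->
  (forall i, exists q, forall x, Q i x -> `|x - q| <= r) ->
  (forall j, measurable (P j)) -> trivIset setT P ->
  (forall j, exists q, forall x, P j x -> `|x - q| <= r) ->
  (forall x, A x -> f x != 0 -> (exists i, Q i x) /\ (exists j, P j x)) ->
  (forall i, 0 <= S i) -> (forall j, 0 <= T j) ->
  (forall i j x, A x -> Q i x -> P j x -> normc (f x) <= S i + T j) ->
  normc (mrestriction nu A f) <= c * (\sum_i S i + \sum_j T j).
Proof.
move=> finA Ab nurc uf mQ tQ Qr mP tP Pr fQP S0 T0 fST.
apply: (ler_addgt0M (mass_ge0 nu A)) => e e0.
have bf := bounded_ucont_borel uf.
have [delta [a [N [d0 Acov fcell]]]] := bounded_ucont_grid uf Ab e0.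
pose K := (@grid_index d N * (I * J))%type : finType.
pose B (t : K) := cell a delta t.1 `&` (Q t.2.1 `&` P t.2.2).
have mB t : measurable (B t).
  by apply: measurableI; [exact: measurable_cell|exact: measurableI].
have tB : trivIset setT B.
  move=> [k [i j]] [k' [i' j']] _ _ [x [[/= xk [xi xj]] [/= xk' [xi' xj']]]].
  rewrite (cell_uniq d0 xk xk'); congr (_, (_, _)).
    by apply: tQ => //; exists x.
  by apply: tP => //; exists x.
pose v t := if pselect (exists x, A x /\ B t x) is left h
  then f (sval (cid h)) else 0.
have vE t x : A x -> B t x -> normc (f x - v t) <= e.
  move=> Ax Bx; rewrite /v; case: pselect => [h|]; last by case; exists x.
  case: (cid h) => y /= [Ay [By _]].
  by apply: fcell By; case: Bx.
have vST t : normc (v t) <= S t.2.1 + T t.2.2.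
  rewrite /v; case: pselect => [h|_]; last by rewrite Normc.normc0 addr_ge0.
  by case: (cid h) => y /= [Ay [_ [Qy Py]]]; exact: fST.
have fB x : A x -> f x != 0 -> exists t, B t x.
  move=> Ax /(fQP _ Ax)[[i Qi] [j Pj]]; have [k xk] := Acov _ Ax.
  by exists (k, (i, j)).
have step := mrestriction_step finA bf (ltW e0) mB tB vE fB.
rewrite -[X in normc X](subrK (\sum_t v t * cmeasure_set nu (A `&` B t))).
rewrite (le_trans (ler_normcD _ _))// lerD//.
rewrite (le_trans (ler_normc_sum _ _ _))//.
pose w t := normc (cmeasure_set nu (A `&` B t)).
have w0 t : 0 <= w t by exact: normc_ge0.
apply: (@le_trans _ _ (\sum_t (S t.2.1 * w t + T t.2.2 * w t))).
  apply: ler_sum => t _; rewrite Normc.normcM -mulrDl.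
  exact: ler_wpM2r (w0 t) _ _ (vST t).
have [mA _] := finA.
have mAB t : measurable (A `&` B t) by exact: measurableI.
have tAB : trivIset setT (fun t => A `&` B t) by exact: trivIset_setIl.
rewrite big_split/= mulrDr lerD//.
  rewrite (partition_big (fun t => t.2.1) xpredT)//= mulr_sumr.
  apply: ler_sum => i _; rewrite (eq_bigr (fun t => S i * w t)); last first.
    by move=> t /eqP ->.
  rewrite -mulr_sumr mulrC ler_wpM2r//; have [q Qq] := Qr i.
  apply: (locally_bounded_sum (q := q) nurc) => // t x /eqP ti [_ [_ [Qx _]]].
  by apply: Qq; rewrite -ti.
rewrite (partition_big (fun t => t.2.2) xpredT)//= mulr_sumr.
apply: ler_sum => j _; rewrite (eq_bigr (fun t => T j * w t)); last first.
  by move=> t /eqP ->.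
rewrite -mulr_sumr mulrC ler_wpM2r//; have [q Pq] := Pr j.
apply: (locally_bounded_sum (q := q) nurc) => // t x /eqP tj [_ [_ [_ Px]]].
by apply: Pq; rewrite -tj.
Qed.

End riemann_sums.

(** * Compactly supported functions and convolutions *)

Section compactness.
Context {R : realType} {d : nat}.
Local Notation E := 'rV[R]_d.
Local Notation C := R[i].
Local Open Scope complex_scope.

Lemma compact_norm_le (A : set E) : compact A ->
  exists2 b : R, 0 <= b & forall x, A x -> `|x| <= b.
Proof.
move=> /compact_bounded[M [_ AM]]; exists (`|M| + 1); first by rewrite addr_ge0.
by move=> x Ax; apply: AM => //; rewrite ltr_pwDr// ler_norm.
Qed.

(** If [x] is not in the set, then each [y] in [B] has a neighbourhood that
    works for all points near [x], and finitely many of them cover [B]. Sums are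
    the case of [phi] the opposite, differences that of [phi] the identity. *)
Lemma closed_add_isometry (A B : set E) (phi : E -> E) :
  (forall x y, `|phi x - phi y| <= `|x - y|) -> closed A -> compact B ->
  closed [set x | exists2 y, B y & A (x + phi y)].
Proof.
move=> phil cA cB; rewrite -[X in closed X]setCK; apply: open_closedC.
rewrite openE => p /= nBA.
have oA : open (~` A) by exact: closed_openC.
have /compact_near_coveringP/(_ _ (nbhs p) (fun x y => ~ A (x + phi y))) := cB.
move=> /(_ (nbhs_filter _)) H.
have {H} : \forall x \near p, B `<=` (fun y => ~ A (x + phi y)).
  apply: H => y By.
  have nA : (~` A) (p + phi y) by move=> Ap; apply: nBA; exists y.
  have /nbhs_ballP[e /= e0 eA] : \forall x \near p + phi y, ~ A x.
    by apply: open_nbhs_nbhs; split.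
  have e20 : 0 < e / 2 by rewrite divr_gt0.
  exists (ball y (e / 2), ball p (e / 2)).
    by split; apply: nbhsx_ballx.
  move=> [y' x'] /=; rewrite -!ball_normE /= => -[yy' xx'].
  apply: eA; rewrite -ball_normE /= opprD addrACA (splitr e).
  by rewrite (le_lt_trans (ler_normD _ _))// ltrD// (le_lt_trans (phil _ _)).
apply: filterS => x Bx /= [y By Axy]; exact: (Bx y By).
Qed.

Lemma closed_minkowski_sum (A B : set E) : closed A -> compact B ->
  closed (minkowski_sum A B).
Proof.
move=> cA cB.
have := @closed_add_isometry A B -%R _ cA cB.
rewrite (_ : [set x | _] = minkowski_sum A B).
  by apply => x y; rewrite -opprD normrN.
apply/seteqP; split => [x [y By Axy]|_ [x Ax [y By <-]]].
  by exists (x - y) => //; exists y => //; rewrite subrK.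
by exists y => //=; rewrite addrK.
Qed.

Lemma closed_minkowski_diff (A B : set E) : closed A -> compact B ->
  closed (minkowski_diff A B).
Proof.
move=> cA cB.
have := @closed_add_isometry A B id _ cA cB.
rewrite (_ : [set x | _] = minkowski_diff A B).
  by apply => x y.
apply/seteqP; split => [x [y By Axy]|_ [x Ax [y By <-]]].
  by exists (x + y) => //; exists y => //; rewrite addrK.
by exists y => //=; rewrite subrK.
Qed.

Lemma fsupp_eq0 (g : E -> C) x : ~ fsupp g x -> g x = 0.
Proof.
move=> gx; apply/eqP; apply: contra_notT gx => gx.
by apply: subset_closure.
Qed.

Lemma Cc_near (g : E -> C) x e : Cc g -> 0 < e ->
  exists2 r : R, 0 < r & forall y, `|x - y| < r -> normc (g x - g y) < e.
Proof.
move=> [cg _] e0.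
have FF : Filter (nbhs x) by exact: nbhs_filter.
have /(@cvgrPdist_lt _ _ _ (nbhs x))/(_ e%:C) := cg x.
rewrite ltcR => /(_ e0) /nbhs_ballP[r /= r0 gr]; exists r => // y xy.
have := gr y; rewrite -ball_normE /= => /(_ xy).
by rewrite normc_def ltcR; case: (g x - g y).
Qed.

(** Compactness of the support gives one radius valid at all its points; a pair
    of close points of which only one is in the support is swapped. *)
Lemma Cc_bounded_ucont (g : E -> C) : Cc g -> bounded_ucont g.
Proof.
move=> Cg; have [_ /compact_near_coveringP cK] := Cg.
split.
  have /(_ (@eventually_filter)) := cK nat \oo (fun n x => normc (g x) <= n%:R).
  have H x : fsupp g x -> \forall y \near x & n \near \oo, normc (g y) <= n%:R.
    move=> _; have [r r0 gr] := Cc_near x Cg ltr01.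
    exists (ball x r, [set n | normc (g x) + 1 <= n%:R]).
      split; first exact: nbhsx_ballx.
      exists (Num.truncn (normc (g x) + 1)).+1 => // n /= hn.
      by rewrite (le_trans (ltW (truncnS_gt _)))// ler_nat.
    move=> [y n] /= []; rewrite -ball_normE /= => /gr xy.
    apply: le_trans; rewrite -[X in normc X](subrK (g x)).
    rewrite (le_trans (ler_normcD _ _))// addrC lerD2l.
    by rewrite -normc_opp opprB ltW.
  move=> /(_ H) [n _ /(_ n (leqnn n)) gn]; exists n%:R => x.
  have [/gn//|/fsupp_eq0 ->] := pselect (fsupp g x).
  by rewrite Normc.normc0.
move=> e e0.
have e20 : 0 < e / 2 by rewrite divr_gt0.
have /(_ (nbhs_filter _)) := cK E (nbhs (0 : E)) (fun v x => normc (g (x + v) - g x) <= e).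
have H x : fsupp g x -> \forall y \near x & v \near (0 : E), normc (g (y + v) - g y) <= e.
  move=> _; have [r r0 gr] := Cc_near x Cg e20.
  have r20 : 0 < r / 2 by rewrite divr_gt0.
  exists (ball x (r / 2), ball 0 (r / 2)); first by split; exact: nbhsx_ballx.
  move=> [y v] /=; rewrite -!ball_normE /= sub0r normrN => -[xy v0].
  have h1 := gr y (lt_le_trans xy _).
  have h2 : normc (g x - g (y + v)) < e / 2.
    apply: gr; rewrite opprD addrA (splitr r).
    by rewrite (le_lt_trans (ler_normB _ _))// ltrD.
  rewrite (_ : g (y + v) - g y = (g x - g y) - (g x - g (y + v))).
    rewrite (le_trans (ler_normcB _ _))// (splitr e) ltW// ltrD//.
    by apply: h1; rewrite ler_pdivrMr// ler_pMr// ler1n.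
  by ring.
move=> /(_ H) /nbhs_ballP[r /= r0 gr].
have r20 : 0 < r / 2 by rewrite divr_gt0.
have rr : r / 2 < r by rewrite ltr_pdivrMr// ltr_pMr// ltr1n.
have sym x y : `|x - y| <= r / 2 -> fsupp g y -> normc (g x - g y) <= e.
  move=> xy gy; have := gr (x - y) _ _ gy; rewrite subrKC; apply.
  by rewrite -ball_normE /= sub0r normrN (le_lt_trans xy).
exists (r / 2) => // x y xy.
have [gy|/fsupp_eq0 gy] := pselect (fsupp g y); first exact: sym.
have [gx|/fsupp_eq0 gx] := pselect (fsupp g x).
  by rewrite -normc_opp opprB; apply: sym => //; rewrite distrC.
by rewrite gx gy subr0 Normc.normc0 ltW.
Qed.

End compactness.

Section convolutions.
Context {R : realType} {d : nat}.
Local Notation E := 'rV[R]_d.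
Local Notation C := R[i].
Local Open Scope complex_scope.

Lemma locally_bounded_ge0 (nu : cmeasure R d) r c :
  locally_bounded_by nu r c -> 0 <= c.
Proof.
move=> /(_ 0 void (fun=> set0)); rewrite big_pred0; last by case.
by apply => // -[].
Qed.

Lemma mconvf_bounded_ucont (nu : cmeasure R d) (A : set E) (g : E -> C) :
  finite_on nu A -> bounded_ucont g ->
  bounded_ucont (mconvf (mrestriction nu A) g).
Proof.
move=> finA ug; have ug' x := bounded_ucont_borel (bounded_ucont_reflect x ug).
have [[S gS] gu] := ug; split.
  exists (mass nu A * S) => x; apply: mrestriction_mass => //.
  exact: le_trans (normc_ge0 (g 0)) (gS 0).
move=> e e0; have M1 : 0 < mass nu A + 1 by rewrite ltr_wpDl// mass_ge0.
have [|delta d0 gd] := gu (e / (mass nu A + 1)); first by rewrite divr_gt0.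
exists delta => // x y xy; rewrite /mconvf -mrestrictionB//.
apply: le_trans (mrestriction_mass finA (S := e / (mass nu A + 1)) _ _ _) _.
- by apply: bounded_borelB.
- by rewrite ltW// divr_gt0.
- by move=> z _; apply: gd; rewrite opprB addrA subrK.
by rewrite mulrA ler_pdivrMr// mulrC ler_wpM2l ?ltW// ltrDl.
Qed.

(** The modulus of continuity does not depend on [A] or [nu], only on the local
    bound: a translate of [g] meets a bounded number of cells. *)
Lemma mconvf_equicontinuous (g : E -> C) (r c e : R) : Cc g -> 0 < r ->
  0 < e -> exists2 delta : R, 0 < delta &
  forall (nu : cmeasure R d) (A : set E), finite_on nu A -> compact A ->
    locally_bounded_by nu r c -> forall x y, `|x - y| <= delta ->
    normc (mconvf (mrestriction nu A) g x - mconvf (mrestriction nu A) g y) <= e.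
Proof.
move=> Cg r0 e0; have [_ Kg] := Cg; have [b b0 gb] := compact_norm_le Kg.
have ug := Cc_bounded_ucont Cg; have [_ gu] := ug.
pose N := (Num.truncn (2 * (b + 1) / r)).+1.
have Nr : 2 * (b + 1) < N%:R * r by rewrite -ltr_pdivrMr// truncnS_gt.
pose M : R := `|c| * #|@grid_index d N|%:R.
have M1 : 0 < M + 1 by rewrite ltr_wpDl// mulr_ge0.
pose e' := e / (M + 1).
have e'0 : 0 < e' by rewrite divr_gt0.
have [delta d0 gd] := gu _ e'0.
exists (Num.min delta 1); first by rewrite lt_min d0 ltr01.
move=> nu A finA cA nuc x y; rewrite le_min => /andP[xyd xy1].
have [B B0 AB] := compact_norm_le cA.
have ugx z := bounded_ucont_reflect z ug.
have [a acov] := @grid_cover R d x (b + 1) r r0.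
pose f z := g (x - z) - g (y - z).
have uf : bounded_ucont f by apply: bounded_ucontB.
have fcell z : A z -> f z != 0 -> exists i : grid_index N, cell a r i z.
  move=> _ fz; apply: acov => //.
  have [/gb xz|/fsupp_eq0 gx] := pselect (fsupp g (x - z)).
    by rewrite distrC (le_trans xz)// lerDl.
  have [/gb yz|/fsupp_eq0 gy] := pselect (fsupp g (y - z)); last first.
    by move: fz; rewrite /f gx gy subrr eqxx.
  rewrite distrC -(subrK y x) -addrA (le_trans (ler_normD _ _))//.
  by rewrite [leRHS]addrC lerD.
rewrite /mconvf -mrestrictionB//; [|exact: bounded_ucont_borel..].
have c0 := locally_bounded_ge0 nuc.
apply: (@le_trans _ _ (c * (\sum_(i : grid_index N) e' + \sum_(i : grid_index N) 0))).
  apply: (@mrestriction_two_partitions _ _ nu A B r c f _ _ (@cell R d a r N)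
    (@cell R d a r N) (fun=> e') (fun=> 0) finA AB nuc uf) => //.
  - by move=> i; exact: measurable_cell.
  - exact: trivIset_cell.
  - by move=> i; exact: cell_ball.
  - by move=> i; exact: measurable_cell.
  - exact: trivIset_cell.
  - by move=> i; exact: cell_ball.
  - by move=> z Az fz; split; exact: fcell.
  - by move=> _; exact: ltW.
  - move=> _ _ z _ _ _; rewrite addr0; apply: gd.
    by rewrite opprB addrA subrK.
rewrite sumr_const big1// addr0 -mulr_natl mulrA -(ger0_norm c0).
by rewrite -/M /e' mulrA ler_pdivrMr// mulrC ler_wpM2l ?ltW// ltrDl.
Qed.

(** Fubini for a uniformly continuous kernel: when [x] is discretized on a fine
    grid, both sides are close to the same finite sum of values of the inner
    integral at the corners of the cells. *)
Lemma mrestriction_swap (nu nu' : cmeasure R d) (A A' : set E)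
    (F : E -> E -> C) (S : R) :
  finite_on nu A -> compact A -> finite_on nu' A' ->
  (forall x y, normc (F x y) <= S) ->
  (forall e : R, 0 < e -> exists2 delta : R, 0 < delta &
     forall x x' y y', `|x - x'| <= delta -> `|y - y'| <= delta ->
       normc (F x y - F x' y') <= e) ->
  mrestriction nu A (fun x => (mrestriction nu' A' (fun y => (F x y)^*))^*) =
  (mrestriction nu' A' (fun y => (mrestriction nu A (fun x => F x y))^*))^*.
Proof.
move=> finA cA finA' FS Fu.
have [b b0 Ab] := compact_norm_le cA.
have uFr x : bounded_ucont (fun y => F x y).
  split; first by exists S.
  move=> e /Fu[delta d0 Fd]; exists delta => // y y' yy'; apply: Fd => //.
  by rewrite subrr normr0 ltW.
have uFl y : bounded_ucont (fun x => F x y).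
  split; first by exists S.
  move=> e /Fu[delta d0 Fd]; exists delta => // x x' xx'; apply: Fd => //.
  by rewrite subrr normr0 ltW.
have bFr x := bounded_ucont_borel (bounded_ucont_conj (uFr x)).
have bFl y := bounded_ucont_borel (uFl y).
have S0 : 0 <= S := le_trans (normc_ge0 _) (FS 0 0).
have m0 := mass_ge0 nu A; have m0' := mass_ge0 nu' A'.
pose L x := (mrestriction nu' A' (fun y => (F x y)^*))^*.
pose G y := mrestriction nu A (fun x => F x y).
have LB x x' t : 0 <= t -> (forall y, normc (F x y - F x' y) <= t) ->
    normc (L x - L x') <= mass nu' A' * t.
  move=> t0 Ft; rewrite /L -rmorphB normc_conj -mrestrictionB//.
  apply: mrestriction_mass => //; first exact: bounded_borelB.
  by move=> y _; rewrite -rmorphB normc_conj.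
have uL : bounded_ucont L.
  split.
    exists (mass nu' A' * S) => x; rewrite /L normc_conj.
    by apply: mrestriction_mass => // y _; rewrite normc_conj.
  move=> e e0; have M1 : 0 < mass nu' A' + 1 by rewrite ltr_wpDl.
  have [|delta d0 Fd] := Fu (e / (mass nu' A' + 1)); first by rewrite divr_gt0.
  exists delta => // x x' xx'; apply: le_trans (LB _ _ (e / (mass nu' A' + 1)) _ _) _.
  - by rewrite ltW// divr_gt0.
  - by move=> y; apply: Fd => //; rewrite subrr normr0 ltW.
  - by rewrite mulrA ler_pdivrMr// mulrC ler_wpM2l ?ltW// ltrDl.
have uG : bounded_ucont G.
  split.
    by exists (mass nu A * S) => y; apply: mrestriction_mass.
  move=> e e0; have M1 : 0 < mass nu A + 1 by rewrite ltr_wpDl.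
  have [|delta d0 Fd] := Fu (e / (mass nu A + 1)); first by rewrite divr_gt0.
  exists delta => // y y' yy'; rewrite /G -mrestrictionB//.
  apply: le_trans (mrestriction_mass finA (S := e / (mass nu A + 1)) _ _ _) _.
  - exact: bounded_borelB.
  - by rewrite ltW// divr_gt0.
  - by move=> x _; apply: Fd => //; rewrite subrr normr0 ltW.
  - by rewrite mulrA ler_pdivrMr// mulrC ler_wpM2l ?ltW// ltrDl.
apply/eqP; rewrite -subr_eq0; apply/eqP/Normc.eq0_normc/eqP.
rewrite eq_le normc_ge0 andbT.
pose MM := 2 * (mass nu A * mass nu' A').
have MM0 : 0 <= MM by rewrite !mulr_ge0.
apply: (ler_addgt0M MM0) => e e0; rewrite addr0.
have [delta d0 Fd] := Fu _ e0.
have [a acov] := @grid_cover R d 0 b delta d0.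
pose N := (Num.truncn (2 * b / delta)).+1.
have Nb : 2 * b < N%:R * delta by rewrite -ltr_pdivrMr// truncnS_gt.
pose p (i : grid_index N) := corner a delta i.
pose w (i : grid_index N) := cmeasure_set nu (A `&` cell a delta i).
have Acov x : A x -> exists i : grid_index N, cell a delta i x.
  by move=> Ax; apply: acov => //; rewrite subr0 Ab.
have pd (i : grid_index N) x : cell a delta i x -> forall y,
    normc (F x y - F (p i) y) <= e.
  move=> xi y; apply: Fd; last by rewrite subrr normr0 ltW.
  by apply: cell_diam xi _ => //; exact: cell_corner.
have mcell (i : grid_index N) : measurable (cell a delta i).
  exact: measurable_cell.
have tcell : trivIset setT (@cell R d a delta N) by exact: trivIset_cell.
pose v (i : grid_index N) := L (p i).
have left : normc (mrestriction nu A L - \sum_i v i * w i) <=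
    mass nu A * (mass nu' A' * e).
  apply: mrestriction_step => //.
  - exact: bounded_ucont_borel.
  - by rewrite mulr_ge0// ltW.
  - by move=> i x Ax xi; apply: LB; [exact: ltW|exact: pd].
  - by move=> x Ax _; exact: Acov.
have right : normc ((mrestriction nu' A' (fun y => (G y)^*))^* -
    \sum_i v i * w i) <= mass nu' A' * (mass nu A * e).
  have -> : \sum_i v i * w i =
      (mrestriction nu' A' (fun y => \sum_i (w i)^* * (F (p i) y)^*))^*.
    rewrite mrestriction_sum//; last first.
      by move=> i; apply: bounded_borelZ; exact: bFr.
    rewrite rmorph_sum; apply: eq_bigr => i _.
    rewrite (mrestrictionZ finA'); last exact: bFr.
    by rewrite (rmorphM (@conjc R)) /= conjcK mulrC.
  have bs : bounded_borel (fun y => \sum_i (w i)^* * (F (p i) y)^*).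
    by apply: bounded_borel_sum => j; apply: bounded_borelZ; exact: bFr.
  have bG : bounded_borel (fun y => (G y)^*).
    exact/bounded_ucont_borel/bounded_ucont_conj.
  rewrite -rmorphB normc_conj -mrestrictionB//.
  apply: mrestriction_mass => //.
  - exact: bounded_borelB.
  - by rewrite mulr_ge0// ltW.
  - move=> y _; rewrite (_ : \sum_i _ = (\sum_i F (p i) y * w i)^*); last first.
      by rewrite rmorph_sum; apply: eq_bigr => i _; rewrite rmorphM mulrC.
    rewrite -rmorphB normc_conj; apply: mrestriction_step => //.
    + exact: ltW.
    + by move=> i x Ax xi; exact: pd.
    + by move=> x Ax _; exact: Acov.
rewrite -/L -/G -(subrK (\sum_i v i * w i) (mrestriction nu A L)) -addrA.
rewrite (le_trans (ler_normcD _ _))//.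
rewrite [leRHS](_ : _ = mass nu A * (mass nu' A' * e) + mass nu' A' * (mass nu A * e));
  last by rewrite /MM; ring.
by apply: lerD => //; rewrite -normc_opp opprB.
Qed.

End convolutions.

(** * Averages over cells and van Hove sequences *)

Section averages.
Context {R : realType} {d : nat}.
Local Notation E := 'rV[R]_d.
Local Notation C := R[i].
Local Notation leb := (@lebesgue_rV R d).
Local Open Scope complex_scope.

Lemma sum_integral_le (I : finType) (F : I -> set E) (D : set E)
    (f : E -> \bar R) :
  (forall i, measurable (F i)) -> trivIset setT F -> measurable D ->
  (forall i, F i `<=` D) -> measurable_fun setT f ->
  (forall x, 0 <= f x)%E ->
  (\sum_i \int[leb]_(x in F i) f x <= \int[leb]_(x in D) f x)%E.
Proof.
move=> mF tF mD FD mf f0.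
rewrite -(ge0_integral_bigsetU leb mF (index_enum_uniq I))//; first last.
- exact: measurable_funS mf.
- exact: sub_trivIset tF.
apply: ge0_subset_integral => //.
- exact: bigsetU_measurable.
- exact: measurable_funS mf.
- by rewrite -bigcup_seq; apply: bigcup_sub => i _; exact: FD.
Qed.

Definition centered_ball (r : R) : set E := [set x | `|x| <= r].

Lemma compact_centered_ball r : compact (centered_ball r).
Proof.
apply: bounded_closed_compact.
  by exists r; split; [exact: num_real|move=> M rM x /= xr; exact: le_trans xr (ltW rM)].
rewrite (_ : centered_ball r = (fun x : E => `|x|) @^-1` [set y : R | y <= r])//.
apply: (@closed_comp _ _ (fun x : E => `|x|)); last exact: closed_le.
by move=> x _; exact: norm_continuous.
Qed.

Lemma lebesgue_bounded_fin (X : set E) (b : R) : measurable X ->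
  (forall x, X x -> `|x| <= b) -> (leb X < +oo)%E.
Proof.
move=> mX Xb; pose c := `|b|.
apply: (@le_lt_trans _ _ (leb (box (const_mx (- c)) (const_mx c)))).
  apply: le_measure; rewrite ?inE//; first exact: measurable_box.
  move=> x /Xb xb i; rewrite !mxE in_itv /= -ler_norml.
  by apply: (rV_normP _ (normr_ge0 b)).1; rewrite (le_trans xb)// ler_norm.
by rewrite lebesgue_rV_box ?ltry// => i; rewrite !mxE (@le_trans _ _ 0) ?oppr_le0 ?normr_ge0.
Qed.

(** Each cell that meets [A] contributes its half-size cube to the neighbourhood
    of [A], and these cubes are disjoint and of equal volume. *)
Lemma card_cells_meeting (A : set E) (a : E) (r Y : R) N : compact A -> 0 < r ->
  (leb (minkowski_sum A (centered_ball r)) <= Y%:E)%E ->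
  \sum_(k : grid_index N) (`[< exists2 x, A x & cell a r k x >])%:R <=
    Y / (r / 2) ^+ d.
Proof.
move=> cA r0 AY; have v0 : 0 < (r / 2) ^+ d by rewrite exprn_gt0// divr_gt0.
rewrite ler_pdivlMr// -lee_fin; apply: le_trans AY.
have mS : measurable (minkowski_sum A (centered_ball r)).
  apply: closed_measurable_rV; apply: closed_minkowski_sum.
    exact: compact_closed (@norm_hausdorff _ _) cA.
  exact: compact_centered_ball.
pose F (k : grid_index N) := if `[< exists2 x, A x & cell a r k x >]
  then half_cell a r k else set0.
have mF k : measurable (F k).
  by rewrite /F; case: ifP => // _; exact: measurable_box.
have tF : trivIset setT F.
  move=> k l _ _ [x []]; rewrite /F; case: ifP => // _ xk; case: ifP => // _ xl.
  by apply: (cell_uniq r0); exact: half_cell_sub.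
have FS k : F k `<=` minkowski_sum A (centered_ball r).
  rewrite /F; case: ifPn => [/asboolP[y Ay yk] x|_]; last exact: sub0set.
  move=> /(half_cell_sub r0) xk.
  exists y => //; exists (x - y); last by rewrite subrKC.
  exact: cell_diam xk yk.
have := @sum_integral_le _ F _ (cst 1%E) mF tF mS FS (measurable_cst _)
  (fun=> lee01).
rewrite integral_cst// mul1e; apply: le_trans.
rewrite mulr_suml -sumEFin; apply: lee_sum => k _.
rewrite integral_cst// mul1e /F; case: ifPn => _; last by rewrite mul0r measure0.
by rewrite [leRHS](lebesgue_half_cell a k r0) mul1r.
Qed.

Lemma normc_measurable (h : E -> C) : bounded_ucont h ->
  measurable_fun setT (fun x => (normc (h x))%:E).
Proof.
move=> [hS hu]; apply/measurable_EFinP.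
have : bounded_ucont (fun x => (normc (h x))%:C).
  split; first by have [S hS'] := hS; exists S => x;
    rewrite normc_real ger0_norm ?normc_ge0.
  move=> e /hu[delta d0 hd]; exists delta => // x y /hd.
  apply: le_trans; rewrite -rmorphB normc_real ler_norml.
  have B (z w : C) : normc z - normc w <= normc (z - w).
    by rewrite lerBlDr -[X in normc X <= _](subrK w) ler_normcD.
  by rewrite B andbT lerNl opprB -[normc (h x - _)]normc_opp opprB B.
by move=> /bounded_ucont_borel[].
Qed.

(** On each small cell the modulus of [h] is at most its mean over a half-size
    cube plus [eta]; the means add up to the integral of [normc \o h], and the
    constant [eta] is charged to the cells of the fixed side [r]. *)
Lemma mrestriction_le_integral (nu : cmeasure R d) (A D : set E)
    (h : E -> C) (r c delta eta X Y : R) (s : E) :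
  finite_on nu A -> compact A -> 0 < r -> locally_bounded_by nu r c ->
  bounded_ucont h -> measurable D -> (forall x, ~ D x -> h x = 0) ->
  0 < delta -> delta <= r -> 0 <= eta ->
  (forall x y, `|x - y| <= delta -> normc (h x - h y) <= eta) ->
  (\int[leb]_(x in D) (normc (h x))%:E <= X%:E)%E ->
  (leb (minkowski_sum A (centered_ball r)) <= Y%:E)%E ->
  normc (mrestriction nu A (fun y => (h (y + s))^*)) <=
    c * (X / (delta / 2) ^+ d + eta * (Y / (r / 2) ^+ d)).
Proof.
move=> finA cA r0 nuc uh mD hD d0 dr eta0 hd DX AY.
have c0 := locally_bounded_ge0 nuc.
have [b b0 Ab] := compact_norm_le cA.
have v0 : 0 < (delta / 2) ^+ d by rewrite exprn_gt0// divr_gt0.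
have mh := normc_measurable uh.
have h0 x : (0 <= (normc (h x))%:E)%E by rewrite lee_fin normc_ge0.
have [a acov] := @grid_cover R d 0 b delta d0.
have [a' acov'] := @grid_cover R d 0 b r r0.
pose N := (Num.truncn (2 * b / delta)).+1.
pose N' := (Num.truncn (2 * b / r)).+1.
have Nb : 2 * b < N%:R * delta by rewrite -ltr_pdivrMr// truncnS_gt.
have Nb' : 2 * b < N'%:R * r by rewrite -ltr_pdivrMr// truncnS_gt.
pose H (i : grid_index N) := half_cell (a + s) delta i.
have mH i : measurable (H i) by exact: measurable_box.
have tH : trivIset setT H.
  move=> i j _ _ [x [xi xj]].
  by apply: (cell_uniq d0); exact: half_cell_sub.
have sumH : (\sum_i \int[leb]_(x in H i) (normc (h x))%:E <= X%:E)%E.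
  apply: le_trans DX.
  apply: le_trans (@sum_integral_le _ H setT _ mH tH measurableT _ mh h0) _ => //.
  rewrite [leRHS]integral_mkcond; apply: ge0_le_integral => //.
  - by apply/(measurable_restrictT _ _).1 => //; exact: measurable_funS mh.
  - move=> x _; rewrite patchE; case: ifPn => // /negP xD.
    by rewrite hD ?Normc.normc0// => Dx; apply: xD; rewrite inE.
have Hfin i : (\int[leb]_(x in H i) (normc (h x))%:E)%E \is a fin_num.
  rewrite ge0_fin_numE; last exact: integral_ge0.
  apply: le_lt_trans (ltry X); apply: le_trans sumH.
  rewrite (bigD1 i)//= leeDl//; apply: sume_ge0 => j _; exact: integral_ge0.
pose S i := fine (\int[leb]_(x in H i) (normc (h x))%:E) / (delta / 2) ^+ d.
have S0 i : 0 <= S i.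
  by rewrite divr_ge0 ?(ltW v0)// fine_ge0//; exact: integral_ge0.
have sumS : \sum_i S i <= X / (delta / 2) ^+ d.
  rewrite -mulr_suml ler_pM2r ?invr_gt0// -lee_fin -sumEFin.
  by under eq_bigr do rewrite fineK//.
pose T (k : grid_index N') : R :=
  eta * (`[< exists2 x, A x & cell a' r k x >])%:R.
have sumT : \sum_k T k <= eta * (Y / (r / 2) ^+ d).
  by rewrite -mulr_sumr ler_wpM2l// card_cells_meeting.
have hS (i : grid_index N) y : cell a delta i y -> normc (h (y + s)) <= S i + eta.
  move=> yi; rewrite -lerBlDr /S ler_pdivlMr// -lee_fin fineK//.
  rewrite EFinM -(lebesgue_half_cell (a + s) i d0) -[leLHS](integral_cst leb (mH i)).
  have [le0|gt0] := leP (normc (h (y + s)) - eta) 0.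
    apply: (@le_trans _ _ 0%E); last exact: integral_ge0.
    by rewrite integral_cst// mule_le0_ge0.
  apply: ge0_le_integral => //.
  - by move=> x _; rewrite lee_fin ltW.
  - exact: measurable_funS mh.
  - move=> x xi; rewrite lee_fin lerBlDr -[X in normc X <= _](subrK (h x)).
    rewrite (le_trans (ler_normcD _ _))// addrC lerD2l; apply: hd.
    apply: cell_diam _ (half_cell_sub d0 xi) => //.
    exact/cell_translate.
apply: (@le_trans _ _ (c * (\sum_i S i + \sum_k T k))); last first.
  by rewrite ler_wpM2l// lerD.
have uf : bounded_ucont (fun y => (h (y + s))^*).
  exact/bounded_ucont_conj/bounded_ucont_shift.
apply: (@mrestriction_two_partitions _ _ nu A b r c _ _ _ (@cell R d a delta N)
  (@cell R d a' r N') S T finA Ab nuc uf) => //.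
- by move=> i; exact: measurable_cell.
- exact: trivIset_cell.
- by move=> i; exact: cell_ball.
- by move=> i; exact: measurable_cell.
- exact: trivIset_cell.
- by move=> i; exact: cell_ball.
- move=> x Ax _; split.
    by apply: acov => //; rewrite subr0 Ab.
  by apply: acov' => //; rewrite subr0 Ab.
- by move=> k; rewrite mulr_ge0.
- move=> i k x Ax xi xk; rewrite normc_conj /T asboolT; last by exists x.
  by rewrite mulr1 hS.
Qed.

(** The points of the neighbourhood outside the interior of [A n] lie in the
    van Hove boundary, whose volume is eventually at most that of [A n]. *)
Lemma van_hove_neighborhood (A : nat -> set E) (r : R) : van_hove A ->
  \forall n \near \oo,
    (leb (minkowski_sum (A n) (centered_ball r)) <= (2 * vol (A n))%:E)%E.
Proof.
move=> [cA _ /(_ _ (@compact_centered_ball r)) /eqoP /(_ 1 ltr01)].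
apply: filterS => n /=; rewrite mul1r.
set B := centered_ball r; set V := van_hove_boundary B (A n).
have clA : closed (A n) := compact_closed (@norm_hausdorff _ _) (cA n).
have [b b0 Ab] := compact_norm_le (cA n).
have mA : measurable (A n) := closed_measurable_rV clA.
have cB : compact B by exact: compact_centered_ball.
have clS : closed (minkowski_sum (A n) B) := closed_minkowski_sum clA cB.
have mS := closed_measurable_rV clS.
have mV : measurable V.
  apply: measurableU.
    apply: measurableD.
      by apply: closed_measurable_rV; exact: closed_closure.
    by apply: open_measurable_rV; exact: open_interior.
  apply: measurableI => //; apply: closed_measurable_rV.
  by apply: closed_minkowski_diff => //; exact: closed_closure.
have Afin : (leb (A n) < +oo)%E by exact: lebesgue_bounded_fin Ab.
have Vfin : (leb V < +oo)%E.
  apply: (@lebesgue_bounded_fin _ (b + `|r|)) => // x [[+ _]|[_ /Ab xb]].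
    rewrite -(closure_id _).1// => -[y /Ab yb [z zr <-]].
    rewrite (le_trans (ler_normD _ _))// lerD//.
    by rewrite (le_trans zr)// ler_norm.
  by rewrite (le_trans xb)// lerDl.
have volV : (leb V = (vol V)%:E)%E.
  by rewrite fineK// ge0_fin_numE.
have volA : (leb (A n) = (vol (A n))%:E)%E.
  by rewrite fineK// ge0_fin_numE.
rewrite !ger0_norm ?fine_ge0// => VA.
apply: (@le_trans _ _ (leb (A n `|` V))).
  apply: le_measure; rewrite ?inE//; first exact: measurableU.
  move=> x Sx; have [/interior_subset|nAx] := pselect ((A n)^° x); first by left.
  by right; left; split => //; exact: subset_closure.
apply: le_trans (measureU2 _ _ _) _ => //.
rewrite [X in (X + _ <= _)%E]volA [X in (_ + X <= _)%E]volV.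
by rewrite -EFinD lee_fin mulr_natl mulr2n lerD2l.
Qed.

End averages.

(** * Differences of autocorrelations *)

Section test_functions.
Context {R : realType} {d : nat}.
Local Notation E := 'rV[R]_d.
Local Notation C := R[i].
Local Open Scope complex_scope.

Lemma normc_lt_complex (e : C) : 0 < e -> exists2 t : R, 0 < t &
  forall z : C, normc z < t -> `|z| < e.
Proof.
rewrite ltcE /= => /andP[/eqP e0 e1]; exists (complex.Re e) => // z zt.
by rewrite normc_def ltcE /= e0 eqxx; case: z zt.
Qed.

Lemma near_continuous (g : E -> C) :
  (forall x (e : R), 0 < e -> exists2 r : R, 0 < r &
    forall y, `|x - y| < r -> normc (g x - g y) < e) ->
  continuous (g : E -> C^o).
Proof.
move=> gn x; have FF : Filter (nbhs x) by exact: nbhs_filter.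
apply/(@cvgrPdist_lt _ _ _ (nbhs x)) => e /normc_lt_complex[t t0 te].
have [r r0 gr] := gn x _ t0.
by have := nbhsx_ballx x _ r0; apply: filterS => y; rewrite -ball_normE => /gr/te.
Qed.

Lemma Cc_conj (g : E -> C) : Cc g -> Cc (fun x => (g x)^*).
Proof.
move=> Cg; split.
  apply: near_continuous => x e e0; have [r r0 gr] := Cc_near x Cg e0.
  by exists r => // y /gr; rewrite -rmorphB normc_conj.
have [_] := Cg; congr compact; rewrite /fsupp; congr closure.
by apply/funext => x /=; rewrite conjc_eq0.
Qed.

Lemma Cc_reflect (g : E -> C) (s : E) : Cc g -> Cc (fun x => g (s - x)).
Proof.
move=> Cg; split.
  apply: near_continuous => x e e0; have [r r0 gr] := Cc_near (s - x) Cg e0.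
  exists r => // y xy; apply: gr.
  by rewrite opprB addrC addrA subrK distrC.
have [_ Kg] := Cg; have [b b0 gb] := compact_norm_le Kg.
apply: bounded_closed_compact; last exact: closed_closure.
exists (`|s| + b); split; first exact: num_real.
move=> M sM x gx; apply: le_trans (ltW sM).
have : closed (centered_ball (`|s| + b) : set E).
  by apply: compact_closed (@norm_hausdorff _ _) _; exact: compact_centered_ball.
move=> /closure_id clX; suff : centered_ball (`|s| + b) x by [].
rewrite clX; apply: closure_subset gx => y /= gy.
have /gb sy : fsupp g (s - y) by exact: subset_closure.
by rewrite /centered_ball /= -(subKr s y) (le_trans (ler_normB _ _))// lerD.
Qed.

Lemma Cc_ftilde (g : E -> C) : Cc g -> Cc (ftilde g).
Proof.
move=> Cg; rewrite (_ : ftilde g = fun x => (g (0 - x))^*).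
  by apply: Cc_conj; exact: Cc_reflect.
by apply/funext => x; rewrite sub0r.
Qed.

End test_functions.

Section autocorrelation.
Context {R : realType} {d : nat}.
Local Notation E := 'rV[R]_d.
Local Notation C := R[i].
Local Open Scope complex_scope.

Lemma compact_finite_on (nu : cmeasure R d) (A : set E) : compact A ->
  finite_on nu A.
Proof.
move=> cA; split; last by move=> k; exact: cpart_lfinite.
by apply: closed_measurable_rV; exact: compact_closed (@norm_hausdorff _ _) cA.
Qed.

Lemma mconvf_supp (nu : cmeasure R d) (A : set E) (g : E -> C) x :
  finite_on nu A -> ~ minkowski_sum (fsupp g) A x ->
  mconvf (mrestriction nu A) g x = 0.
Proof.
move=> finA gAx; rewrite -[RHS](mrestriction0 finA).
apply: eq_mrestriction => y Ay; apply: fsupp_eq0 => gxy; apply: gAx.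
by exists (x - y) => //; exists y => //; rewrite subrK.
Qed.

(** The two terms of [mu * mu~ - om * om~ = (mu - om) * mu~ + om * (mu - om)~]
    evaluated at a test function, the first one after exchanging the
    integrations so that in both the inner integral is against [mu - om]. *)
Lemma autocorrelation_sub (mu om : cmeasure R d) (A : set E) (g : E -> C) t :
  compact A -> Cc g ->
  let N := mrestriction mu A in let N' := mrestriction om A in
  mconv N (mtilde N) (fun y => g (t - y)) -
  mconv N' (mtilde N') (fun y => g (t - y)) =
  (N (fun y => (mconvf N g (y + t) - mconvf N' g (y + t))^*))^* +
  N' (fun x => (mconvf N (ftilde g) (x - t) - mconvf N' (ftilde g) (x - t))^*).
Proof.
move=> cA Cg N N'.
have finA nu : finite_on nu A by exact: compact_finite_on.
have ug := Cc_bounded_ucont Cg; have ug' := Cc_bounded_ucont (Cc_ftilde Cg).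
have [[S gS] gu] := ug.
pose F x y := g (t - (x - y)).
have FS x y : normc (F x y) <= S by exact: gS.
have Fu (e : R) : 0 < e -> exists2 delta : R, 0 < delta &
    forall x x' y y', `|x - x'| <= delta -> `|y - y'| <= delta ->
       normc (F x y - F x' y') <= e.
  move=> /gu[delta d0 gd]; exists (delta / 2); first by rewrite divr_gt0.
  move=> x x' y y' xx' yy'; apply: gd.
  rewrite (_ : _ - _ = (y - y') - (x - x')); last first.
    by apply/rowP => j; rewrite !mxE; ring.
  by rewrite (splitr delta) (le_trans (ler_normB _ _))// lerD.
have uN nu : bounded_ucont (mconvf (mrestriction nu A) g).
  exact: mconvf_bounded_ucont.
have uN' nu : bounded_ucont (mconvf (mrestriction nu A) (ftilde g)).
  exact: mconvf_bounded_ucont.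
have bconv nu : bounded_borel
    (fun y => (mconvf (mrestriction nu A) g (y + t))^*).
  exact/bounded_ucont_borel/bounded_ucont_conj/bounded_ucont_shift.
have bconv' nu : bounded_borel
    (fun x => (mconvf (mrestriction nu A) (ftilde g) (x - t))^*).
  exact/bounded_ucont_borel/bounded_ucont_conj/bounded_ucont_shift.
have convE (nu : cmeasure R d) (f : functional R d) :
    mconv f (mtilde (mrestriction nu A)) (fun y => g (t - y)) =
    f (fun x => (mrestriction nu A (fun y => (F x y)^*))^*).
  by rewrite /mconv /mtilde /ftilde.
have innerE nu x : (mrestriction nu A (fun y => (F x y)^*))^* =
    (mconvf (mrestriction nu A) (ftilde g) (x - t))^*.
  congr (_^*); congr (mrestriction nu A _); apply/funext => y.
  rewrite /ftilde /F; congr (_^*); congr g.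
  by apply/rowP => j; rewrite !mxE; ring.
have outerE nu y : mrestriction nu A (fun x => F x y) =
    mconvf (mrestriction nu A) g (y + t).
  congr (mrestriction nu A _); apply/funext => x; rewrite /F; congr g.
  by apply/rowP => j; rewrite !mxE; ring.
pose P nu x := (mconvf (mrestriction nu A) (ftilde g) (x - t))^*.
have swapE nu : mrestriction nu A (P mu) =
    (N (fun y => (mconvf (mrestriction nu A) g (y + t))^*))^*.
  rewrite (_ : P mu = fun x => (mrestriction mu A (fun y => (F x y)^*))^*).
    rewrite (mrestriction_swap (finA nu) cA (finA mu) FS Fu).
    rewrite (_ : (fun y => _) =
      (fun y => (mconvf (mrestriction nu A) g (y + t))^*)); first by [].
    by apply/funext => y; rewrite (outerE nu y).
  by apply/funext => x; rewrite innerE.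
rewrite !convE (_ : (fun x => _) = P mu); last first.
  by apply/funext => x; rewrite innerE.
rewrite (_ : (fun x => _) = P om); last first.
  by apply/funext => x; rewrite innerE.
have -> : N (P mu) - N' (P om) = (N (P mu) - N' (P mu)) + (N' (P mu) - N' (P om)).
  by rewrite addrA subrK.
congr (_ + _).
  rewrite /N /N' (swapE mu) (swapE om) -rmorphB.
  rewrite -(mrestrictionB (finA mu) (bconv mu) (bconv om)).
  rewrite (_ : (fun y => _) = (fun y => (mconvf N g (y + t) -
    mconvf N' g (y + t))^*))//.
  by apply/funext => y; rewrite rmorphB.
rewrite /N' -(mrestrictionB (finA om) (bconv' mu) (bconv' om)).
rewrite (_ : (fun y => _) = (fun x => (mconvf N (ftilde g) (x - t) -
  mconvf N' (ftilde g) (x - t))^*))//.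
by apply/funext => y; rewrite /P rmorphB.
Qed.

(** The integral of [normc \o h n] is negligible against the volume by mean
    convergence, and the functions [h n] have a common modulus of continuity, so
    the integral of [h n] against any measure with the same local bound is
    negligible as well. *)
Lemma mean_null_negligible (A : nat -> set E) (mu om : nat -> cmeasure R d)
    (g : E -> C) (r c e : R) :
  let h n x := mconvf (mrestriction (mu n) (A n)) g x -
    mconvf (mrestriction (om n) (A n)) g x in
  van_hove A -> 0 < r -> (forall n, locally_bounded_by (mu n) r c) ->
  (forall n, locally_bounded_by (om n) r c) -> Cc g ->
  limn_esup (fun n => ((vol (A n))^-1%:E *
    \int[@lebesgue_rV R d]_(x in minkowski_sum (fsupp g) (A n))
      (normc (h n x))%:E)%E) = 0%E ->
  0 < e ->
  \forall n \near \oo, 0 < vol (A n) -> forall nu s,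
    locally_bounded_by nu r c ->
    normc (mrestriction nu (A n) (fun y => (h n (y + s))^*)) <= e * vol (A n).
Proof.
move=> h vhA r0 muc omc Cg h0 e0.
have [cA _ _] := vhA.
have c0 := locally_bounded_ge0 (muc 0%N).
have w0 : 0 < (r / 2) ^+ d by rewrite exprn_gt0// divr_gt0.
have c1 : 0 < c + 1 by rewrite ltr_wpDl.
(* Chosen so that c * eta * (2 * vol (A n) / w) <= e / 2 * vol (A n), where w is
   the volume of a half-size cube of the fixed side [r]. *)
pose eta := e / 2 / ((c + 1) * (2 / (r / 2) ^+ d)).
have eta0 : 0 < eta by rewrite !divr_gt0// mulr_gt0// divr_gt0.
have eta20 : 0 < eta / 2 by rewrite divr_gt0.
have [delta' d'0 equi] := mconvf_equicontinuous c Cg r0 eta20.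
pose delta := Num.min delta' r.
have d0 : 0 < delta by rewrite lt_min d'0.
have dr : delta <= r by rewrite ge_min lexx orbT.
have v0 : 0 < (delta / 2) ^+ d by rewrite exprn_gt0// divr_gt0.
pose x0 := e / 2 / (c + 1) * (delta / 2) ^+ d.
have x00 : 0 < x0 by rewrite mulr_gt0// !divr_gt0.
have /fine_cvgP[ufin /cvgrPdist_lt/(_ _ x00) usmall] :
    ((vol (A n))^-1%:E * \int[@lebesgue_rV R d]_(x in minkowski_sum (fsupp g) (A n))
      (normc (h n x))%:E)%E @[n --> \oo] --> 0%E.
  apply: limn_esup_le_cvg; first by rewrite h0.
  move=> n; apply: mule_ge0; first by rewrite lee_fin invr_ge0 fine_ge0.
  by apply: integral_ge0 => x _; rewrite lee_fin normc_ge0.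
have := van_hove_neighborhood r vhA.
apply: filterS3 ufin usmall => n ufin usmall AY vol0 nu s nuc.
have fin m : finite_on m (A n) by exact: compact_finite_on.
have uh : bounded_ucont (h n).
  apply: bounded_ucontB; apply: mconvf_bounded_ucont => //;
  exact: Cc_bounded_ucont.
have clA : closed (A n) := compact_closed (@norm_hausdorff _ _) (cA n).
have mD : measurable (minkowski_sum (fsupp g) (A n)).
  apply: closed_measurable_rV; apply: closed_minkowski_sum => //.
  exact: closed_closure.
have hD x : ~ minkowski_sum (fsupp g) (A n) x -> h n x = 0.
  by move=> Dx; rewrite /h !mconvf_supp// subr0.
have hd x y : `|x - y| <= delta -> normc (h n x - h n y) <= eta.
  rewrite le_min => /andP[xy _]; rewrite /h.
  rewrite (_ : _ - _ = (mconvf (mrestriction (mu n) (A n)) g x -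
    mconvf (mrestriction (mu n) (A n)) g y) -
    (mconvf (mrestriction (om n) (A n)) g x -
    mconvf (mrestriction (om n) (A n)) g y)); last by ring.
  by rewrite (le_trans (ler_normcB _ _))// (splitr eta) lerD// equi.
have DX : (\int[@lebesgue_rV R d]_(x in minkowski_sum (fsupp g) (A n))
    (normc (h n x))%:E <= (x0 * vol (A n))%:E)%E.
  have I0 : (0 <= \int[@lebesgue_rV R d]_(x in minkowski_sum (fsupp g) (A n))
      (normc (h n x))%:E)%E.
    by apply: integral_ge0 => x _; rewrite lee_fin normc_ge0.
  move: ufin usmall I0 => /=; case: (integral _ _ _) => [I _|+ _ _|//].
    rewrite /= sub0r normrN => + I0; rewrite lee_fin in I0.
    have V0 : 0 <= (vol (A n))^-1 by rewrite invr_ge0 ltW.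
    rewrite ger0_norm ?(mulr_ge0 V0 I0)// => /ltW.
    by rewrite mulrC ler_pdivrMr// lee_fin.
  by rewrite gt0_muley// lte_fin invr_gt0.
apply: le_trans (mrestriction_le_integral s (fin nu) (cA n) r0 nuc uh mD hD d0 dr
  (ltW eta0) hd DX AY) _.
rewrite /x0 /eta mulrDr.
set w := (r / 2) ^+ d; set v := (delta / 2) ^+ d; set V := vol (A n).
have -> : e * V = e / 2 * V + e / 2 * V by rewrite -mulrDl -splitr.
have cc1 : c / (c + 1) <= 1 by rewrite ler_pdivrMr// mul1r lerDl.
have eV : 0 <= e / 2 * V by rewrite mulr_ge0 ?ltW// divr_gt0.
have vN : v != 0 by rewrite gt_eqF.
have wN : w != 0 by rewrite gt_eqF.
have cN : c + 1 != 0 by rewrite gt_eqF.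
apply: lerD.
  rewrite (_ : _ * _ = (c / (c + 1)) * (e / 2 * V)); last first.
    by field; rewrite cN.
  by rewrite ler_piMl.
rewrite (_ : _ * _ = (c / (c + 1)) * (e / 2 * V)); last first.
  by field; rewrite cN.
by rewrite ler_piMl.
Qed.

End autocorrelation.

(** * Convergence *)

Section pi_convergence.
Context {R : realType} {d : nat}.
Local Notation E := 'rV[R]_d.
Local Notation C := R[i].
Local Open Scope complex_scope.

(** The support hypothesis is applied to the inner integral first; what remains
    is then a bounded uniformly continuous function of the outer variable. *)
Lemma mconv_supported (mu : cmeasure R d) (A : set E) (g : E -> C) t :
  finite_cmeasure mu -> compact A -> csupp mu `<=` A -> Cc g ->
  mconv mu (mtilde mu) (fun y => g (t - y)) =
  mconv (mrestriction mu A) (mtilde (mrestriction mu A)) (fun y => g (t - y)).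
Proof.
move=> finmu cA muA Cg.
have clA : closed A := compact_closed (@norm_hausdorff _ _) cA.
have innerE x : mtilde mu (fun y => g (t - (x + y))) =
    mtilde (mrestriction mu A) (fun y => g (t - (x + y))).
  rewrite /mtilde (cmeasure_supported finmu clA muA)//.
  apply: bounded_ucont_borel; apply: Cc_bounded_ucont; apply: Cc_ftilde.
  rewrite (_ : (fun y => _) = fun y => g (t - x - y)).
    exact: Cc_reflect.
  by apply/funext => y; rewrite opprD addrA.
rewrite /mconv (_ : (fun x => _) = fun x =>
  mtilde (mrestriction mu A) (fun y => g (t - (x + y)))); last first.
  by apply/funext => x; rewrite innerE.
rewrite (cmeasure_supported finmu clA muA)//.
have -> : (fun x => mtilde (mrestriction mu A) (fun y => g (t - (x + y)))) =
    (fun x => (mconvf (mrestriction mu A) (ftilde g) (x - t))^*).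
  apply/funext => x; rewrite /mtilde /mconvf; congr (_^*).
  congr (mrestriction mu A _); apply/funext => y; rewrite /ftilde.
  by congr (_^*); congr g; apply/rowP => j; rewrite !mxE; ring.
apply/bounded_ucont_borel/bounded_ucont_conj/bounded_ucont_shift.
apply: mconvf_bounded_ucont; first exact: compact_finite_on.
exact/Cc_bounded_ucont/Cc_ftilde.
Qed.

Lemma autocorrelation_sub_small (A : nat -> set E) (mu om : nat -> cmeasure R d)
    (g : E -> C) (r c e : R) :
  van_hove A -> 0 < r -> (forall n, locally_bounded_by (mu n) r c) ->
  (forall n, locally_bounded_by (om n) r c) -> Cc g ->
  mean_null A (fun n => msubf (mrestriction (mu n) (A n))
    (mrestriction (om n) (A n))) -> 0 < e ->
  \forall n \near \oo, forall t,
    let N := mrestriction (mu n) (A n) in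
    let N' := mrestriction (om n) (A n) in
    normc (((vol (A n))^-1)%:C *
      (mconv N (mtilde N) (fun y => g (t - y)) -
       mconv N' (mtilde N') (fun y => g (t - y)))) <= e.
Proof.
move=> vhA r0 muc omc Cg null e0.
have [cA _ _] := vhA.
have e20 : 0 < e / 2 by rewrite divr_gt0.
have K := mean_null_negligible vhA r0 muc omc Cg (null _ Cg) e20.
have K' := mean_null_negligible vhA r0 muc omc (Cc_ftilde Cg)
  (null _ (Cc_ftilde Cg)) e20.
apply: filterS2 K K' => n K K' t.
rewrite Normc.normcM normc_real.
have : 0 <= vol (A n) by rewrite fine_ge0.
rewrite le_eqVlt => /predU1P[<-|V0].
  by rewrite invr0 normr0 mul0r ltW.
rewrite gtr0_norm ?invr_gt0// mulrC ler_pdivrMr// autocorrelation_sub//.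
rewrite (le_trans (ler_normcD _ _))// normc_conj (splitr e) mulrDl lerD//.
  by apply: K.
by apply: K'.
Qed.

End pi_convergence.

Theorem theorem8p6 (R : realType) (d : nat) (omega gamma : cmeasure R d)
    (A : nat -> set 'rV[R]_d) (mu : nat -> cmeasure R d)
    (omegaTB : translation_bounded omega)
    (AvH : van_hove A)
    (autocorr : vague_limit
      (fun n => mscalef (vol (A n))^-1
         (mconv (mrestriction omega (A n)) (mtilde (mrestriction omega (A n))))) gamma)
    (muF : forall n, finite_cmeasure (mu n))
    (muS : forall n, csupp (mu n) `<=` A n)
    (muTB : equi_translation_bounded mu)
    (mu_omega : mean_null A (fun n => msubf (mu n) (mrestriction omega (A n)))) :
  pi_null (fun n => mscalef (vol (A n))^-1
    (msubf (mconv (mu n) (mtilde (mu n)))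
          (mconv (mrestriction omega (A n)) (mtilde (mrestriction omega (A n)))))) /\
  vague_limit
    (fun n => mscalef (vol (A n))^-1 (mconv (mu n) (mtilde (mu n)))) gamma.
Proof.
have [cA _ _] := AvH.
have clA n : closed (A n) := compact_closed (@norm_hausdorff _ _) (cA n).
have [r1 [c1 [r10 omc]]] := translation_bounded_locally_bounded omegaTB.
have [K /tnorm_locally_bounded[r2 r20 Kr] [c2 muc]] := muTB.
pose r := Num.min r1 r2; pose c := Num.max c1 c2.
have r0 : 0 < r by rewrite lt_min r10.
have {}omc : locally_bounded_by omega r c.
  by apply: locally_bounded_byW omc; rewrite ?ge_min ?le_max lexx.
have {}muc n : locally_bounded_by (mu n) r c.
  apply: locally_bounded_byW (Kr _ _ (muc n));
  by rewrite ?ge_min ?le_max lexx orbT.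
have null : mean_null A (fun n => msubf (mrestriction (mu n) (A n))
    (mrestriction omega (A n))).
  move=> g Cg; pose mean (h : nat -> 'rV[R]_d -> R[i]) :=
    limn_esup (fun n => ((vol (A n))^-1%:E *
      \int[@lebesgue_rV R d]_(x in minkowski_sum (fsupp g) (A n))
        (normc (h n x))%:E)%E).
  rewrite -/(mean (fun n => mconvf (msubf _ _) g)).
  rewrite (_ : (fun n => _) =
    (fun n => mconvf (msubf (mu n) (mrestriction omega (A n))) g)).
    exact: mu_omega.
  apply/funext => n; apply/funext => x; rewrite /mconvf /msubf; congr (_ - _).
  rewrite (cmeasure_supported (muF n) (clA n) (@muS n))//.
  exact/bounded_ucont_borel/bounded_ucont_reflect/Cc_bounded_ucont.
have small g e : Cc g -> 0 < e -> \forall n \near \oo, forall t,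
    normc (mconvf (mscalef (vol (A n))^-1 (msubf (mconv (mu n) (mtilde (mu n)))
      (mconv (mrestriction omega (A n)) (mtilde (mrestriction omega (A n))))))
      g t) <= e.
  move=> Cg e0.
  have := autocorrelation_sub_small AvH r0 muc (fun=> omc) Cg null e0.
  apply: filterS => n h t; move: (h t) => /=.
  by rewrite -(mconv_supported t (muF n) (cA n) (@muS n) Cg).
split.
  move=> g Cg.
  have sup e : 0 < e -> \forall n \near \oo, (0 <= supnorm (mconvf (mscalef
      (vol (A n))^-1 (msubf (mconv (mu n) (mtilde (mu n)))
      (mconv (mrestriction omega (A n)) (mtilde (mrestriction omega (A n))))))
      g) <= e%:E)%E.
    move=> e0; apply: filterS (small g e Cg e0) => n h; apply/andP; split.
      apply: ereal_sup_ge; eexists; first by exists 0.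
      by rewrite lee_fin normc_ge0.
    by apply: ge_ereal_sup => _ [t _ <-]; rewrite lee_fin; exact: h.
  apply/fine_cvgP; split.
    apply: filterS (sup 1 ltr01) => n /andP[h0 h1].
    by rewrite ge0_fin_numE// (le_lt_trans h1)// ltry.
  apply/cvgrPdist_le => e /sup; apply: filterS => n /= /andP[].
  case: supnorm => [s| |] //=; rewrite ?lee_fin// => s0 se.
  by rewrite sub0r normrN ger0_norm.
move=> g Cg.
set nu' := fun n => mscalef (vol (A n))^-1
  (mconv (mrestriction omega (A n)) (mtilde (mrestriction omega (A n)))).
set nu := fun n => mscalef (vol (A n))^-1 (mconv (mu n) (mtilde (mu n))).
have -> : (fun n => nu n g : R[i]^o) =
    (fun n => (nu n g - nu' n g : R[i]^o) + (nu' n g : R[i]^o)).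
  by apply/funext => n; rewrite subrK.
rewrite -[X in _ --> X]add0r; apply: cvgD; last exact: autocorr.
apply/cvgrPdist_lt => e /normc_lt_complex[t t0 te].
have t20 : 0 < t / 2 by rewrite divr_gt0.
(* The value at [g] is the convolution with the reflected function, at 0. *)
apply: filterS (small (fun y => g (0 - y)) _ (Cc_reflect 0 Cg) t20) => n h.
apply: te; rewrite sub0r normc_opp; apply: (@le_lt_trans _ _ (t / 2)); last first.
  by rewrite ltr_pdivrMr// ltr_pMr// ltr1n.
apply: le_trans (h 0); rewrite /mconvf /mscalef /msubf.
rewrite (_ : (fun y => _) = g) ?mulrBr//.
by apply/funext => y; rewrite !sub0r opprK.
Qed.
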